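(* A finitely generated subgroup of the topological full group of a minimal subshift can have each of the following behaviours: (1) there exist a minimal subshift $(X,\varphi)$ and a finitely generated subgroup of $[[\varphi]]$ that has intermediate growth; (2) there exist a minimal subshift $(X,\varphi)$ and a finitely generated subgroup of $[[\varphi]]$ that is an infinite torsion group; (3) there exist a minimal subshift $(X,\varphi)$ and a finitely generated subgroup of $[[\varphi]]$ that is residually finite but not elementary amenable.
   Context: A Cantor minimal system is a pair $(X,\varphi)$ where $X$ is a compact space homeomorphic to the Cantor set and $\varphi$ is a homeomorphism of $X$ all of whose orbits are dense. Its topological full group $[[\varphi]]$ is the group of all homeomorphisms $g$ of $X$ for which there is a continuous function $n:X\to\mathbb{Z}$ with $g(x)=\varphi^{n(x)}(x)$ for every $x\in X$. A subshift over a finite alphabet $\mathcal{A}$ is a closed shift-invariant subset $X\subset\mathcal{A}^{\mathbb{Z}}$ together with the restriction $\varphi$ of the shift map; a minimal subshift here is a subshift that is a Cantor minimal system (i.e. an infinite subshift all of whose orbits are dense). For a group $G$ with finite symmetric generating set $S$, the growth function $b_{G,S}(n)$ is the number of elements of $G$ that can be written as a product of at most $n$ elements of $S$. The growth is polynomial if there are $C,D>0$ with $b_{G,S}(n)\le Cn^D$ for all $n\ge1$, exponential if there is $c>1$ with $b_{G,S}(n)\ge c^n$ for all $n\ge 1$, and intermediate otherwise; this does not depend on $S$. A torsion group is a group all of whose elements have finite order. The class of elementary amenable groups is the smallest class of groups containing finite and abelian groups and closed under taking extensions, inductive limits, subgroups and quotients. *)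

(* Defs.v *)
From HB Require Import structures.
From mathcomp Require Import all_boot all_order all_algebra fingroup finmap.
From mathcomp Require Import all_classical all_reals all_analysis.

Set Implicit Arguments.
Unset Strict Implicit.
Unset Printing Implicit Defensive.

Import Order.TTheory GRing.Theory Num.Theory.

Local Open Scope classical_set_scope.
Local Open Scope group_scope.

Definition expgz (G : groupType) (x : G) (n : int) : G :=
  match n with Posz m => x ^+ m | Negz m => x ^- m.+1 end.

Record subgroup (G : groupType) := Subgroup {
  subgroup_set :> set G;
  subgroup1 : subgroup_set 1;
  subgroupF : forall x y, subgroup_set x -> subgroup_set y ->
    subgroup_set (x / y) }.

Section SubgroupType.
Variables (G : groupType) (H : subgroup G).

Definition subgroup_type : Type := {x : G | x \in (H : set G)}.

HB.instance Definition _ := SubChoice.on subgroup_type.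

Lemma subgroup_closed : group_closed (mem (H : set G)).
Proof.
split; first by rewrite inE; exact: subgroup1.
by move=> x y; rewrite !inE => Hx Hy; exact: subgroupF.
Qed.

HB.instance Definition _ :=
  SubChoice_isSubGroup.Build G _ subgroup_type subgroup_closed.

End SubgroupType.

Section GroupProperties.
Variable G : groupType.

(* The subgroup generated by S is the whole group. *)
Definition generating_set (S : {fset G}) : Prop :=
  forall K : subgroup G, [set` S] `<=` K -> (K : set G) = [set: G].

Definition finitely_generated : Prop :=
  exists S : {fset G}, generating_set S.

Definition symmetric_set (S : {fset G}) : Prop :=
  forall s, s \in S -> s^-1 \in S.

Definition word_ball (S : {fset G}) (n : nat) : set G :=
  [set g | exists w : seq G, [/\ (size w <= n)%N,
     {subset w <= S} & g = \prod_(s <- w) s]].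

(* [word_ball S n] is finite, so [fset_set] enumerates it faithfully. *)
Definition growth_function (S : {fset G}) (n : nat) : nat :=
  #|` fset_set (word_ball S n)|%fset.

Definition torsion_group : Prop :=
  forall g : G, exists2 n : nat, (0 < n)%N & g ^+ n = 1.

Definition residually_finite : Prop :=
  forall g : G, g <> 1 ->
    exists (F : finGroupType) (f : {multiplicative G -> F}), f g <> 1.

End GroupProperties.

Section Growth.
Variable R : realType.
Local Open Scope ring_scope.

Definition polynomial_growth (b : nat -> nat) : Prop :=
  exists C D : R, [/\ 0 < C, 0 < D &
    forall n : nat, (1 <= n)%N -> (b n)%:R <= C * n%:R `^ D].

Definition exponential_growth (b : nat -> nat) : Prop :=
  exists2 c : R, 1 < c &
    forall n : nat, (1 <= n)%N -> c ^+ n <= (b n)%:R.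

(* The growth type does not depend on the finite symmetric generating set, so
   quantifying over all of them agrees with choosing one; finite generation is
   part of the definition so that the quantification is not vacuous. *)
Definition intermediate_growth (G : groupType) : Prop :=
  finitely_generated G /\
  forall S : {fset G}, symmetric_set S -> generating_set S ->
    ~ polynomial_growth (growth_function S) /\
    ~ exponential_growth (growth_function S).

End Growth.

Record directed_system := DirectedSystem {
  ds_index : Type;
  ds_le : ds_index -> ds_index -> Prop;
  ds_le_refl : forall i, ds_le i i;
  ds_le_trans : forall i j k, ds_le i j -> ds_le j k -> ds_le i k;
  ds_directed : forall i j, exists k, ds_le i k /\ ds_le j k;
  ds_group : ds_index -> groupType;
  ds_map : forall i j, ds_le i j -> {multiplicative ds_group i -> ds_group j};
  ds_map_id : forall i (ii : ds_le i i) x, ds_map ii x = x;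
  ds_map_comp : forall i j k (ij : ds_le i j) (jk : ds_le j k)
    (ik : ds_le i k) x, ds_map jk (ds_map ij x) = ds_map ik x }.

Arguments ds_group : clear implicits.

(* Via the maps [c], G is the quotient of the disjoint union of the groups of
   the system in which two elements are identified when their images agree
   further along. *)
Definition inductive_limit (D : directed_system) (G : groupType)
    (c : forall i, {multiplicative ds_group D i -> G}) : Prop :=
  [/\ forall i j (ij : ds_le i j) x, c j (ds_map ij x) = c i x,
      forall g, exists i x, c i x = g &
      forall i j x y, c i x = c j y ->
        exists k (ik : ds_le i k) (jk : ds_le j k), ds_map ik x = ds_map jk y].

Inductive elementary_amenable : groupType -> Prop :=
| EA_finite (G : groupType) :
    finite_set [set: G] -> elementary_amenable G
| EA_abelian (G : groupType) :
    (forall x y : G, x * y = y * x) -> elementary_amenable G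
| EA_extension (N G Q : groupType)
    (i : {multiplicative N -> G}) (p : {multiplicative G -> Q}) :
    injective i -> (forall q, exists g, p g = q) ->
    (forall g, p g = 1 <-> exists n, i n = g) ->
    elementary_amenable N -> elementary_amenable Q -> elementary_amenable G
| EA_limit (D : directed_system) (G : groupType)
    (c : forall i, {multiplicative ds_group D i -> G}) :
    inductive_limit c -> (forall i, elementary_amenable (ds_group D i)) ->
    elementary_amenable G
| EA_subgroup (H G : groupType) (i : {multiplicative H -> G}) :
    injective i -> elementary_amenable G -> elementary_amenable H
| EA_quotient (G Q : groupType) (p : {multiplicative G -> Q}) :
    (forall q, exists g, p g = q) ->
    elementary_amenable G -> elementary_amenable Q.

Record homeomorphism (X Y : topologicalType) := Homeomorphism {
  homeo_fun :> X -> Y;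
  homeo_inv : Y -> X;
  homeo_funK : cancel homeo_fun homeo_inv;
  homeo_invK : cancel homeo_inv homeo_fun;
  homeo_continuous : continuous homeo_fun;
  homeo_inv_continuous : continuous homeo_inv }.

HB.instance Definition _ (X Y : topologicalType) :=
  gen_eqMixin (homeomorphism X Y).
HB.instance Definition _ (X Y : topologicalType) :=
  gen_choiceMixin (homeomorphism X Y).

Section HomeoGroup.
Variable X : topologicalType.
Implicit Types f g h : homeomorphism X X.

Lemma homeo_ext f g : f =1 g -> f = g.
Proof.
case: f g => [f f' fK f'K cf cf'] [g g' gK g'K cg cg'] /= fg.
have {fg}/funext fg : f =1 g by []. subst g.
have fg' : f' = g' by apply/funext => x; rewrite -{1}(g'K x) fK.
subst g'; congr Homeomorphism; exact: Prop_irrelevance.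
Qed.

Definition homeo_one : homeomorphism X X :=
  @Homeomorphism X X id id (fun=> erefl) (fun=> erefl)
    (fun=> cvg_id) (fun=> cvg_id).

Definition homeo_mul f g : homeomorphism X X :=
  @Homeomorphism X X (f \o g) (homeo_inv g \o homeo_inv f)
    (can_comp (@homeo_funK _ _ f) (@homeo_funK _ _ g))
    (can_comp (@homeo_invK _ _ g) (@homeo_invK _ _ f))
    (fun x => continuous_comp (@homeo_continuous _ _ g x)
                              (@homeo_continuous _ _ f (g x)))
    (fun x => continuous_comp (@homeo_inv_continuous _ _ f x)
                              (@homeo_inv_continuous _ _ g _)).

Definition homeo_invg f : homeomorphism X X :=
  @Homeomorphism X X (homeo_inv f) f (@homeo_invK _ _ f) (@homeo_funK _ _ f)
    (@homeo_inv_continuous _ _ f) (@homeo_continuous _ _ f).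

Lemma homeo_mulA : associative homeo_mul.
Proof. by move=> f g h; exact: homeo_ext. Qed.

Lemma homeo_mul1 : left_id homeo_one homeo_mul.
Proof. by move=> f; exact: homeo_ext. Qed.

Lemma homeo_1mul : right_id homeo_one homeo_mul.
Proof. by move=> f; exact: homeo_ext. Qed.

Lemma homeo_mulVg : left_inverse homeo_one homeo_invg homeo_mul.
Proof. by move=> f; apply: homeo_ext; exact: homeo_funK. Qed.

Lemma homeo_mulgV : right_inverse homeo_one homeo_invg homeo_mul.
Proof. by move=> f; apply: homeo_ext; exact: homeo_invK. Qed.

HB.instance Definition _ := isGroup.Build (homeomorphism X X)
  homeo_mulA homeo_mul1 homeo_1mul homeo_mulVg homeo_mulgV.

Lemma homeoM f g x : (f * g) x = f (g x). Proof. by []. Qed.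

Lemma homeo1 x : (1 : homeomorphism X X) x = x. Proof. by []. Qed.

End HomeoGroup.

Definition cantor_minimal_system (X : topologicalType)
    (phi : homeomorphism X X) : Prop :=
  [/\ compact [set: X],
      inhabited (homeomorphism X cantor_space) &
      forall x : X, dense (range (fun n : int => expgz phi n x))].

Lemma oppSD1 (k : nat) : (- k.+1%:Z + 1 = - k%:Z)%R.
Proof. by rewrite intS opprD addrAC addNr add0r. Qed.

Lemma expgzS (G : groupType) (x : G) (n : int) :
  expgz x (n + 1)%R = expgz x n * x.
Proof.
case: n => [m|[|m]].
- by rewrite addrC -intS /= expgSr.
- by rewrite /= expg1 mulVg.
- have -> : (Negz m.+1 + 1 = Negz m)%R by rewrite !NegzE oppSD1.
  by rewrite /= [in RHS]expgS invgM mulgVK.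
Qed.

Lemma expgzD (G : groupType) (x : G) (m n : int) :
  expgz x (m + n)%R = expgz x m * expgz x n.
Proof.
elim/int_rec: n => [|n IH|n IH].
- by rewrite addr0 /= mulg1.
- by rewrite intS (addrC 1%R) addrA !expgzS IH mulgA.
- apply: (mulIg x); rewrite -mulgA -!expgzS.
  by rewrite -!addrA oppSD1 IH.
Qed.

Section FullGroup.
Variables (X : topologicalType) (phi : homeomorphism X X).

Definition full_group_set : set (homeomorphism X X) :=
  [set g | exists n : X -> discrete_topology int,
     continuous n /\ forall x, g x = expgz phi (n x) x].

Lemma full_group1 : full_group_set 1.
Proof.
exists (fun=> (0%R : int)); split => // x; exact: cst_continuous.
Qed.

Lemma full_groupF g h :
  full_group_set g -> full_group_set h -> full_group_set (g / h).
Proof.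
move=> [m [mc gE]] [n [nc hE]].
exists (fun x => (m (homeo_inv h x) - n (homeo_inv h x))%R); split=> [x|x].
  have locally_cst (k : X -> discrete_topology int) : continuous k ->
      \forall y \near x, k (homeo_inv h y) = k (homeo_inv h x).
    move=> kc; have kh := continuous_comp (@homeo_inv_continuous _ _ h x) (kc _).
    exact: (kh [set k (homeo_inv h x)]) (discrete_set1 _).
  move=> U /nbhs_singleton Ux /=.
  refine (filterS _ (filterI (locally_cst _ mc) (locally_cst _ nc))).
  by move=> y [/= e1 e2]; rewrite /preimage /= e1 e2.
have -> : (g / h) x = g (homeo_inv h x) by [].
have := hE (homeo_inv h x); rewrite homeo_invK; move: (homeo_inv h x) => y ->.
by rewrite gE -homeoM -expgzD subrK.
Qed.

Definition full_group : subgroup (homeomorphism X X) :=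
  Subgroup full_group1 full_groupF.

End FullGroup.

Lemma continuous_prod (I : Type) (T : topologicalType)
    (K : I -> topologicalType) (f : T -> prod_topology K) :
  (forall i, continuous (fun x => f x i)) -> continuous f.
Proof.
move=> cf x; apply/cvg_sup => i.
exact: (@continuous_comp_initial _ T _ (fun y : forall i, K i => y i) f (cf i) x).
Qed.

Section Subshift.
Variable A : finType.

Definition full_shift : topologicalType :=
  prod_topology (fun _ : int => discrete_topology A).

Definition shift (x : full_shift) : full_shift := fun n => x (n + 1)%R.
Definition unshift (x : full_shift) : full_shift := fun n => x (n - 1)%R.

Record subshift := Subshift {
  subshift_set :> set full_shift;
  subshift_closed : closed subshift_set;
  subshift_invariant : shift @` subshift_set = subshift_set }.

Variable X : subshift.

Lemma shiftK : cancel shift unshift.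
Proof. by move=> x; apply/funext => n; rewrite /shift /unshift subrK. Qed.

Lemma unshiftK : cancel unshift shift.
Proof. by move=> x; apply/funext => n; rewrite /shift /unshift addrK. Qed.

Lemma shift_in (x : X) : shift (val x) \in (X : set full_shift).
Proof.
by rewrite inE -[X in X _]subshift_invariant; exists (val x) => //; exact: set_valP.
Qed.

Lemma unshift_in (x : X) : unshift (val x) \in (X : set full_shift).
Proof.
have := set_valP x; rewrite -[X in X _]subshift_invariant => -[y Xy yx].
by rewrite inE /set_val /= -yx shiftK.
Qed.

Definition sub_shift (x : X) : X := exist _ (shift (val x)) (shift_in x).
Definition sub_unshift (x : X) : X := exist _ (unshift (val x)) (unshift_in x).

Lemma sub_shiftK : cancel sub_shift sub_unshift.
Proof. by move=> x; apply: val_inj; rewrite /= shiftK. Qed.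

Lemma sub_unshiftK : cancel sub_unshift sub_shift.
Proof. by move=> x; apply: val_inj; rewrite /= unshiftK. Qed.

Lemma translation_continuous (k : int) :
  continuous ((fun x n => x (n + k)%R) : full_shift -> full_shift).
Proof.
apply: (@continuous_prod int full_shift (fun=> discrete_topology A)) => i.
exact: (@proj_continuous int (fun=> discrete_topology A)).
Qed.

Lemma sub_shift_continuous : continuous sub_shift.
Proof.
apply: (@continuous_comp_initial X X full_shift set_val) => x.
apply: (@continuous_comp X full_shift full_shift set_val shift).
  exact: (@initial_continuous X full_shift set_val).
exact: translation_continuous.
Qed.

Lemma sub_unshift_continuous : continuous sub_unshift.
Proof.
apply: (@continuous_comp_initial X X full_shift set_val) => x.
apply: (@continuous_comp X full_shift full_shift set_val unshift).
  exact: (@initial_continuous X full_shift set_val).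
exact: translation_continuous.
Qed.

Definition subshift_map : homeomorphism X X :=
  Homeomorphism sub_shiftK sub_unshiftK
    sub_shift_continuous sub_unshift_continuous.

Definition minimal_subshift : Prop := cantor_minimal_system subshift_map.

End Subshift.

(* Main.v *)
Require Import Defs.
From HB Require Import structures.
From mathcomp Require Import all_boot all_order all_algebra fingroup perm finmap.
From mathcomp Require Import zify ring lra.
From mathcomp Require Import all_classical all_reals all_analysis.

(** The three subgroups are one and the same, the Grigorchuk group G: the group
    generated by the involutions a, b, c, d acting on binary words, where a
    flips the first bit and b = (a, c), c = (a, d), d = (1, b) act on the rest of
    the word according to the first bit. A word w in the letters thus has two
    sections, which describe its action behind the first bits 0 and 1.

    Embedding. The orbits of G on the words of length N are paths with 2 ^ N
    vertices. Read along such a path, the letters that act on an edge follow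
    the ruler pattern: every odd edge is crossed by a, and the edge n, for n
    even, by two of b, c, d, the missing one depending on the 2-adic valuation
    of n modulo 3. The resulting biinfinite sequence of labels is aperiodic and
    uniformly recurrent, so its orbit closure X is a minimal subshift. A letter
    acts on x in X by moving the origin across the adjacent edge on which it is
    active, which is an element of the topological full group. A word acts on
    X as a walk on the labelled line Z; the line is self-similar under
    grouping its a-edges, which yields equivariant maps from Z to the words of
    length N ([walk1_address]). Therefore a word is trivial on X exactly when
    it is trivial on all binary words ([word_homeo_eqact]), and the subgroup
    of the full group is G.

    Properties of G. With suitable weights on the letters, the two sections
    of a reduced word have total weight about 6 / 7 of that of the word. This
    contraction gives torsion, by induction on the weight ([word_torsion]), and
    turns an exponential bound of rate r on the growth into one of rate
    13 r / 14, so the growth is not exponential ([covering_exp]). In the other direction a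
    substitution of Lysenok turns pairs of elements into elements of comparable
    length, whence 2 ^ (2 ^ k) elements in balls of radius O(8 ^ k)
    ([size_spread]): G is infinite and its growth is not polynomial. The actions
    on words of bounded length show that G is residually finite. Finally, all
    torsion sections of an elementary amenable group are locally finite
    ([elementary_amenable_sections]), so a finitely generated infinite torsion
    group is not elementary amenable. *)

Set Implicit Arguments.
Unset Strict Implicit.
Unset Printing Implicit Defensive.

Import Order.TTheory GRing.Theory Num.Theory numFieldNormedType.Exports.

Local Open Scope classical_set_scope.

(** * The Grigorchuk group acting on binary words *)

Inductive letter := La | Lb | Lc | Ld.

Definition letter_code (s : letter) : bool * bool :=
  match s with
  | La => (false, false) | Lb => (false, true)
  | Lc => (true, false) | Ld => (true, true)
  end.

Definition letter_decode (p : bool * bool) : letter :=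
  match p with
  | (false, false) => La | (false, true) => Lb
  | (true, false) => Lc | (true, true) => Ld
  end.

Lemma letter_codeK : cancel letter_code letter_decode.
Proof. by case. Qed.

HB.instance Definition _ := Countable.copy letter (can_type letter_codeK).
HB.instance Definition _ := Finite.copy letter (can_type letter_codeK).

Section Words.
Implicit Types (s t : letter) (w v : seq letter) (u : seq bool) (e : bool).

(** The recursion b = (a, c), c = (a, d), d = (1, b) behind the first bit, with
    None for the identity. *)
Definition letter_sec s e : option letter :=
  match s, e with
  | La, _ => None
  | Lb, false => Some La | Lb, true => Some Lc
  | Lc, false => Some La | Lc, true => Some Ld
  | Ld, false => None | Ld, true => Some Lb
  end.

Fixpoint letter_act s u : seq bool :=
  if u is e :: u' then
    if s == La then ~~ e :: u'
    else e :: (if letter_sec s e is Some t then letter_act t u' else u')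
  else [::].

Definition act w u := foldr letter_act u w.

Definition oseq (o : option letter) := if o is Some t then [:: t] else [::].

Definition flips w := odd (count_mem La w).

(** Each letter reads the first bit e after the letters on its right have
    flipped it. *)
Fixpoint sec w e : seq letter :=
  if w is s :: w' then oseq (letter_sec s (e (+) flips w')) ++ sec w' e
  else [::].

Definition eqact w v := act w =1 act v.
Definition triv w := act w =1 id.

Lemma letter_act_cons s e u :
  letter_act s (e :: u) = (e (+) (s == La)) :: act (oseq (letter_sec s e)) u.
Proof. by case: s; case: e. Qed.

Lemma act_cat w v u : act (w ++ v) u = act w (act v u).
Proof. exact: foldr_cat. Qed.

Lemma flips_cat w v : flips (w ++ v) = flips w (+) flips v.
Proof. by rewrite /flips count_cat oddD. Qed.

Lemma act_cons w e u : act w (e :: u) = (e (+) flips w) :: act (sec w e) u.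
Proof.
elim: w => [|s w IH]; first by rewrite addbF.
rewrite [act (s :: w) _]/= IH letter_act_cons act_cat /flips /= oddD.
by rewrite -/(flips w) oddb; congr (_ :: _); rewrite [RHS]addbA addbAC.
Qed.

Lemma sec_cat w v e : sec (w ++ v) e = sec w (e (+) flips v) ++ sec v e.
Proof.
elim: w => //= s w ->; by rewrite flips_cat catA [flips w (+) _]addbC addbA.
Qed.

Lemma act_nil w : act w [::] = [::].
Proof. by elim: w => //= s w ->. Qed.

Lemma eqact_cons w v : flips w = flips v ->
  (forall e, eqact (sec w e) (sec v e)) -> eqact w v.
Proof. by move=> fwv swv [|e u]; rewrite ?act_nil// !act_cons fwv swv. Qed.

Lemma eqact_sec w v e : eqact w v -> eqact (sec w e) (sec v e).
Proof. by move=> wv u; have := wv (e :: u); rewrite !act_cons => -[]. Qed.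

Lemma eqact_cat w w' v v' : eqact w w' -> eqact v v' -> eqact (w ++ v) (w' ++ v').
Proof. by move=> ww vv u; rewrite !act_cat ww vv. Qed.

Definition klein s t : seq letter :=
  match s, t with
  | Lb, Lc | Lc, Lb => [:: Ld]
  | Lb, Ld | Ld, Lb => [:: Lc]
  | Lc, Ld | Ld, Lc => [:: Lb]
  | _, _ => [::]
  end.

Lemma letter_actK s : involutive (letter_act s).
Proof.
move=> u; elim: u s => // e u IH s.
by case: s; case: e => //=; rewrite IH.
Qed.

Definition same_class s t := (s == La) == (t == La).

(** With 1, the letters b, c, d form a Klein four-group: on the half 0 each
    relation reduces to a a = 1 or a = a, on the half 1 to the relation obtained
    by the cyclic shift b, c, d, so all of them follow by one induction on the depth. *)
Lemma klein_act s t : same_class s t -> eqact [:: s; t] (klein s t).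
Proof.
move=> st u; elim: u s t st => [|e u IH] s t st; first by case: s st; case: t.
have := IH Lc Ld isT; have := IH Ld Lc isT.
have := IH Lb Ld isT; have := IH Ld Lb isT; have := IH Lb Lc isT.
have := IH Lc Lb isT; rewrite /eqact /= => bc cb bd db cd dc.
by move: st; case: s; case: t; case: e => //= _; rewrite ?letter_actK ?bc ?cb
  ?bd ?db ?cd ?dc.
Qed.

Lemma act_rev w : cancel (act w) (act (rev w)).
Proof.
by elim: w => //= s w IH u; rewrite rev_cons -cats1 act_cat /= letter_actK IH.
Qed.

Lemma act_inj w : injective (act w).
Proof. exact: can_inj (act_rev w). Qed.

(** * Weights and contraction *)

(** These weights make both reductions strict: a product of two letters among
    b, c, d is lighter than the two, and the sections of b, c, d weigh
    together exactly 1 less than b a, c a, d a. *)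
Definition letter_weight s := match s with La => 3 | Lb => 4 | Lc => 3 | Ld => 2 end.
Definition weight w := sumn (map letter_weight w).

Lemma weight_cons s w : weight (s :: w) = letter_weight s + weight w.
Proof. by []. Qed.

Lemma weight_cat w v : weight (w ++ v) = weight w + weight v.
Proof. by rewrite /weight map_cat sumn_cat. Qed.

Lemma size_weight w : size w <= weight w.
Proof. by elim: w => //= s w; rewrite /weight /=; case: s => /=; lia. Qed.

(** A letter b, c or d hands down its weight plus 2 to its two sections, and a
    loses its weight 3; the number of letters other than a is written as
    size minus count. *)
Lemma weight_sec w :
  weight (sec w false) + weight (sec w true) + 5 * count_mem La w =
  weight w + 2 * size w.
Proof.
elim: w => // s w; rewrite [sec _ false]/= [sec _ true]/= !weight_cat weight_cons.
rewrite [size _]/= (_ : count_mem La (s :: w) = (s == La) + count_mem La w)//.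
set x := weight (sec _ _).
set y := weight (sec _ _); set c := count_mem La w.
by case: s; case: (flips w); rewrite /weight /=; lia.
Qed.

Definition alternating w := sorted (fun s t => ~~ same_class s t) w.

Lemma klein_weight s t : same_class s t ->
  weight (klein s t) < letter_weight s + letter_weight t.
Proof. by case: s; case: t. Qed.

Lemma reduce_step w : ~~ alternating w ->
  exists2 w', eqact w w' & weight w' < weight w.
Proof.
elim: w => // s [|t w] IH //.
rewrite /alternating [sorted _ _]/= negb_and negbK => /orP[st|/IH[w' ww' lt]].
  exists (klein s t ++ w).
    by rewrite -[s :: t :: w]/([:: s; t] ++ w); apply: eqact_cat => //; exact: klein_act.
  by rewrite weight_cat; have := klein_weight st; rewrite /weight /=; lia.
exists (s :: w').
  by move=> u; have /= -> := ww' u.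
by rewrite /weight /=; move: lt; rewrite /weight /=; lia.
Qed.

Lemma reduce w : exists w', [/\ eqact w w', alternating w' & weight w' <= weight w].
Proof.
have [n] := ubnP (weight w); elim: n w => // n IH w lt.
have [aw|/reduce_step[v wv ltv]] := boolP (alternating w); first by exists w.
have [|w' [vw' aw' le]] := IH v; first by lia.
exists w'; split=> //; last lia.
by move=> u; rewrite wv vw'.
Qed.

(** Every second letter is a, up to the choice made at the two ends. *)
Lemma alternating_count s w : path (fun s t => ~~ same_class s t) s w ->
  2 * count_mem La (s :: w) = size w + (s == La) + (last s w == La).
Proof.
elim: w s => [|t w IH] s /=; first by case: s.
move=> /andP[st /IH /= E]; move: st; rewrite /same_class.
by case: (s == La) E; case: (t == La) => //=; lia.
Qed.

(** Let p be the number of letters other than a. There are at least p - 1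
    letters a, so the sections weigh at most weight w - p + 3, and at most
    p + 1, so weight w <= 7 p + 3. Eliminating p gives the bound. *)
Lemma weight_sec_alternating w : alternating w ->
  7 * (weight (sec w false) + weight (sec w true)) <= 6 * weight w + 24.
Proof.
case: w => // s w /alternating_count; have := weight_sec (s :: w).
set x := weight (sec _ _); set y := weight (sec _ _).
have : weight (s :: w) + 1 * count_mem La (s :: w) <= 4 * size (s :: w).
  elim: (s :: w) => // t v; rewrite /weight /=; case: t => /=; lia.
have : size (s :: w) = (size w).+1 by [].
set c := count_mem _ _; set k := size (_ :: _); set W := weight _.
by case: (s == La); case: (last s w == La); lia.
Qed.

(** * Torsion *)

Definition finite_order w := exists2 n, 0 < n & iter n (act w) =1 id.

Lemma eqact_order w v : eqact w v -> finite_order v -> finite_order w.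
Proof. by move=> wv [n n0 vn]; exists n => // u; rewrite (eq_iter wv). Qed.

Lemma order_rot w v : finite_order (w ++ v) -> finite_order (v ++ w).
Proof.
move=> [n n0 wv1]; exists n => // u; apply: (@act_inj w).
rewrite -[RHS]wv1; elim: n {n0 wv1} => // n IH; rewrite !iterS -IH.
by rewrite !act_cat.
Qed.

Lemma order_square w : finite_order (w ++ w) -> finite_order w.
Proof.
move=> [n n0 ww1]; exists (n * 2); first by lia.
by move=> u; rewrite iterM -[RHS]ww1; apply: eq_iter => v; rewrite act_cat.
Qed.

Lemma order_sections w : ~~ flips w ->
  (forall e, finite_order (sec w e)) -> finite_order w.
Proof.
move=> /negbTE fw ow; have [n0 n0_gt0 w0] := ow false.
have [n1 n1_gt0 w1] := ow true; exists (n0 * n1); first by rewrite muln_gt0 n0_gt0.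
have step m e u : iter m (act w) (e :: u) = e :: iter m (act (sec w e)) u.
  by elim: m => //= m ->; rewrite act_cons fw addbF.
have iter1 f m k : iter m f =1 id -> iter (k * m) f =1 (id : seq bool -> _).
  by move=> fm x; elim: k => // k IH; rewrite mulSn iterD IH fm.
case=> [|e u]; last first.
  by rewrite step; case: e; [rewrite (iter1 _ _ _ w1)|rewrite mulnC (iter1 _ _ _ w0)].
by elim: (_ * _) => //= m ->; exact: act_nil.
Qed.

(** The first and the last letter are then of different kinds as well. *)
Lemma alternating_rot s w : w != [::] -> alternating (s :: w) ->
  alternating (rcons w s) ->
  2 * count_mem La (s :: w) = size (s :: w).
Proof.
case: w => // t w _ aw; rewrite /alternating /= rcons_path => /andP[_].
rewrite (alternating_count aw) /same_class /=.
by case: (s == La); case: (last t w == La) => //=; lia.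
Qed.

(** Induction on the weight, up to cyclic rotation, which is conjugation. A word
    that does not alternate cyclically becomes lighter after one reduction.
    A cyclically alternating word has as many letters a as other letters, so
    its two sections together are lighter than the word. If the word fixes
    the first bit, its order divides the product of the orders of its sections;
    otherwise its square has the two products of the sections as sections. *)
Lemma word_torsion w : finite_order w.
Proof.
have [n] := ubnP (weight w); elim: n w => // n IH w ltn.
have shorter v v' : eqact v v' -> weight v' < weight w -> finite_order v.
  by move=> vv' lt; apply: (eqact_order vv'); apply: IH; lia.
have [aw|/reduce_step[v wv /(shorter _ _ wv)//]] := boolP (alternating w).
case: w => [|s w] in ltn shorter aw *; first by exists 1.
have [->|w0] := eqVneq w [::].
  by exists 2 => // u; rewrite /= letter_actK.
rewrite -cat1s; apply: order_rot; rewrite cats1.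
have [arw|/reduce_step[v wv ltv]] := boolP (alternating (rcons w s)); last first.
  apply: shorter wv _; move: ltv; rewrite -cats1 weight_cat !weight_cons.
  by rewrite (_ : weight [::] = 0)// addn0 addnC.
have count2 := alternating_rot w0 aw arw.
rewrite -cats1; apply: order_rot; rewrite cat1s.
have := weight_sec (s :: w); rewrite -count2.
have : 0 < count_mem La (s :: w) by move: count2 => /=; lia.
have [fl|fl] := boolP (flips (s :: w)) => a0 lt; last first.
  by apply: order_sections => // -[]; apply: IH; lia.
apply: order_square; apply: order_sections; first by rewrite flips_cat addbb.
move=> e; rewrite sec_cat fl; apply: IH; rewrite addbT weight_cat.
by case: e; rewrite [~~ _]/=; lia.
Qed.

(** * Superpolynomially many elements *)

(** Lysenok's substitution: one section of sigma w is w itself, and the other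
    one, theta w, lies in the finite dihedral group generated by a and d. *)
Definition letter_sigma s : seq letter :=
  match s with
  | La => [:: La; Lc; La] | Lb => [:: Ld] | Lc => [:: Lb] | Ld => [:: Lc]
  end.
Definition sigma w := flatten (map letter_sigma w).

Definition letter_theta s : seq letter :=
  match s with La => [:: Ld] | Lb => [::] | Lc => [:: La] | Ld => [:: La] end.
Definition theta w := flatten (map letter_theta w).

Lemma sigma_cat w v : sigma (w ++ v) = sigma w ++ sigma v.
Proof. by rewrite /sigma map_cat flatten_cat. Qed.

Lemma theta_cat w v : theta (w ++ v) = theta w ++ theta v.
Proof. by rewrite /theta map_cat flatten_cat. Qed.

Lemma flips_sigma w : flips (sigma w) = false.
Proof. by elim: w => //= s w IH; rewrite flips_cat IH; case: s. Qed.

Lemma sec_sigma w e : sec (sigma w) e = if e then w else theta w.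
Proof.
elim: w => [|s w IH]; first by case: e.
by rewrite /= sec_cat IH flips_sigma {IH}; case: s; case: e.
Qed.

(** When theta w and theta v act trivially, the sections of this word are v on
    the half 0 and w on the half 1. *)
Definition pair_word w v := sigma w ++ [:: La] ++ sigma v ++ [:: La].

Lemma sec_pair_word w v e :
  sec (pair_word w v) e = if e then w ++ theta v else theta w ++ v.
Proof.
by rewrite !sec_cat !sec_sigma !flips_cat !flips_sigma; case: e; rewrite /= ?cats0.
Qed.

(** A condition that lets pair_word pair two elements and that is inherited by
    the pair. The third iterate theta (sigma (sigma w)) is a power of a whose
    exponent is the number of letters b and c, so parities are enough to
    control all further iterates. *)
Definition sigma_trivial w :=
  [/\ forall s, ~~ odd (count_mem s w), triv (theta w) & triv (theta (sigma w))].

Lemma theta_sigma2 w u :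
  act (theta (sigma (sigma w))) u =
  iter (count_mem Lb w + count_mem Lc w) (letter_act La) u.
Proof.
elim: w => //= s w IH; rewrite sigma_cat theta_cat act_cat IH.
case: s => //=; rewrite ?letter_actK ?add0n ?add1n ?addnS//.
Qed.

Lemma count_sigma s w : count_mem s (sigma w) =
  match s with
  | La => 2 * count_mem La w | Lb => count_mem Lc w
  | Lc => count_mem La w + count_mem Ld w | Ld => count_mem Lb w
  end.
Proof.
elim: w => [|t w IH]; first by case: s.
by rewrite /= count_cat IH; case: s {IH}; case: t => /=; lia.
Qed.

Lemma iter_letter_even s n u : ~~ odd n -> iter n (letter_act s) u = u.
Proof.
move=> en; rewrite -(odd_double_half n) (negbTE en) add0n -muln2 iterM.
by elim: n./2 => //= m ->; exact: letter_actK.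
Qed.

Lemma sigma_trivial_pair w v :
  sigma_trivial w -> sigma_trivial v -> sigma_trivial (pair_word w v).
Proof.
move=> [ew tw tsw] [ev tv tsv]; have even2 x : sigma_trivial x -> triv (theta (sigma (sigma x))).
  by case=> ex _ _ u; rewrite theta_sigma2 iter_letter_even// oddD !(negbTE (ex _)).
split.
- move=> s; rewrite !count_cat !count_sigma.
  have := ew La; have := ew Lb; have := ew Lc; have := ew Ld.
  have := ev La; have := ev Lb; have := ev Lc; have := ev Ld.
  by case: s => /=; lia.
- by move=> u; rewrite !theta_cat !act_cat /= tsv tsw letter_actK.
- move=> u; rewrite !sigma_cat !theta_cat !act_cat (even2 v)// (even2 w)//.
  by rewrite /= !letter_actK.
Qed.

(** A set of N elements of length at most l gives N ^ 2 elements of length at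
    most 8 l, namely its pairs: iterating from 1 and (ab)^2 produces
    2 ^ (2 ^ k) elements in a ball of radius of order 8 ^ k. *)
Fixpoint spread k : seq (seq letter) :=
  if k is k'.+1 then allpairs pair_word (spread k') (spread k')
  else [:: [::]; [:: La; Lb; La; Lb]].

Lemma spread_trivial k w : w \in spread k -> sigma_trivial w.
Proof.
elim: k w => [|k IH] w; last first.
  by move=> /allpairsP[[x y] [/IH tx /IH ty ->]]; exact: sigma_trivial_pair.
rewrite !inE => /orP[] /eqP->; split=> //; try by case.
  by move=> u; rewrite /= !letter_actK.
(* theta (sigma (abab)) spells (da)^4, whose sections are squares of b. *)
by case=> [|e [|f u]]; first [by []|case: e; try case: f]; rewrite /= ?letter_actK.
Qed.

Lemma size_spread k : size (spread k) = 2 ^ (2 ^ k).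
Proof.
by elim: k => // k IH; rewrite size_allpairs IH -expnD addnn -mul2n -expnS.
Qed.

Lemma size_sigma w : size (sigma w) <= 3 * size w.
Proof. by elim: w => // s w IH; rewrite (sigma_cat [:: s]) size_cat; case: s => /=; lia. Qed.

Lemma spread_length k w : w \in spread k -> size w <= 4 * 8 ^ k.
Proof.
elim: k w => [|k IH] w; first by rewrite !inE => /orP[] /eqP->.
move=> /allpairsP[[x y] /= [/IH lx /IH ly ->]]; rewrite !size_cat /=.
have := size_sigma x; have := size_sigma y; rewrite expnS.
by have := expn_gt0 8 k; lia.
Qed.

Lemma spread_pair k w v w' v' :
    w \in spread k -> v \in spread k -> w' \in spread k -> v' \in spread k ->
  eqact (pair_word w v) (pair_word w' v') -> eqact w w' /\ eqact v v'.
Proof.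
have tt z : z \in spread k -> triv (theta z) by move=> /spread_trivial[].
move=> kw kv kw' kv' E; split=> u.
  by have := eqact_sec true E u; rewrite !sec_pair_word !act_cat !tt.
by have := eqact_sec false E u; rewrite !sec_pair_word !act_cat !tt.
Qed.

Lemma spread_inj k : {in spread k &, forall w v, eqact w v -> w = v}.
Proof.
elim: k => [|k IH] w v.
  by rewrite !inE => /orP[] /eqP-> /orP[] /eqP-> //= /(_ [:: false; false]).
move=> /allpairsP[[x y] /= [kx ky ->]] /allpairsP[[x' y'] /= [kx' ky' ->]].
by move=> /(spread_pair kx ky kx' ky')[/IH-> // /IH->].
Qed.

Lemma spread_uniq k : uniq (spread k).
Proof.
elim: k => // k IH; apply: allpairs_uniq => //.
move=> _ _ /allpairsP[[x y] /= [kx ky ->]] /allpairsP[[x' y'] /= [kx' ky' ->]] E.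
have [] := spread_pair kx ky kx' ky'; first by move: E => /= ->.
by move=> /(spread_inj kx kx')-> /(spread_inj ky ky')->.
Qed.

End Words.

(** * The line with ruler labels *)

(** The a-edges are the odd ones; every other edge is labelled by the one letter
    among b, c, d that does not act along it. *)
Definition label (j : nat) : letter :=
  if j is j'.+1 then
    match j' %% 3 with 0 => Ld | 1 => Lc | _ => Lb end
  else La.

Definition active (s t : letter) : bool :=
  if s == La then t == La else (t != La) && (t != s).

Lemma active_La t : active La t = (t == La). Proof. by []. Qed.

Section Line.
Local Open Scope ring_scope.

(** The value c at 0 is kept free because halving the line changes it. *)
Definition ruler (c : nat) (n : int) : nat :=
  if n == 0 then c else logn 2 `|n|%N.

Definition edge c n := label (ruler c n).

(** The edge n joins the vertices n and n + 1. *)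
Definition walk1 (x : int -> letter) (s : letter) (n : int) : int :=
  if active s (x n) then n + 1
  else if active s (x (n - 1)) then n - 1 else n.

Definition walk x (w : seq letter) (n : int) := foldr (walk1 x) n w.

(** The a-edges join the vertices 2 k - 1 and 2 k into pairs, which are the
    vertices of a line of the same kind. *)
Definition block (n : int) : int := ((n + 1) %/ 2)%Z.
Definition oddz (n : int) : bool := odd `|n|%N.

(** The bit separates the two vertices of a pair. It is oriented so that an even
    edge joins two vertices with the same bit, as it must for b, c, d, which
    never change the first bit. *)
Fixpoint address (N : nat) (n : int) : seq bool :=
  if N is N'.+1 then (oddz n == oddz (block n)) :: address N' (block n)
  else [::].

Lemma int_half n : exists k : int, n = 2 * k \/ n = 2 * k - 1.
Proof. exists (block n); rewrite /block; lia. Qed.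

Lemma block_even k : block (2 * k) = k. Proof. rewrite /block; lia. Qed.
Lemma block_odd k : block (2 * k - 1) = k. Proof. rewrite /block; lia. Qed.
Lemma oddz_even k : oddz (2 * k) = false. Proof. rewrite /oddz; lia. Qed.
Lemma oddz_odd k : oddz (2 * k - 1) = true. Proof. rewrite /oddz; lia. Qed.
Lemma oddzS k : oddz (k + 1) = ~~ oddz k. Proof. rewrite /oddz; lia. Qed.
Lemma oddzB1 k : oddz (k - 1) = ~~ oddz k. Proof. rewrite /oddz; lia. Qed.

Lemma ruler_odd c n : oddz n -> ruler c n = 0%N.
Proof.
rewrite /ruler /oddz => on; case: eqP => [n0|_]; first by rewrite n0 in on.
apply/eqP; rewrite -leqn0 leqNgt logn_gt0 mem_primes.
by move: on; rewrite dvdn2; case: odd; rewrite // !andbF.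
Qed.

Lemma edge_odd c n : oddz n -> edge c n = La.
Proof. by move=> on; rewrite /edge ruler_odd. Qed.

(** Halving lowers the valuation by 1. At 0 there is nothing to lower, and c + 2
    plays the role of c - 1, labels having period 3. *)
Lemma edge_even c k : (0 < c)%N -> edge c (2 * k) = label (ruler c.+2 k).+1.
Proof.
move=> c0; rewrite /edge /ruler mulf_eq0 /=; case: eqP => [_|/eqP k0].
  by case: c c0 => // c _; rewrite /label -[in RHS](addn3 c) modnDr.
rewrite abszM lognM ?absz_gt0//= (_ : logn 2 2 = 1%N)//.
Qed.

Lemma ruler_even_gt0 c k : (0 < c)%N -> ~~ oddz k -> (0 < ruler c k)%N.
Proof.
rewrite /ruler /oddz => c0 ek; case: eqP => // /eqP k0.
by rewrite logn_gt0 mem_primes /= absz_gt0 k0 dvdn2.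
Qed.

Lemma edge_eqLa c n : (0 < c)%N -> (edge c n == La) = oddz n.
Proof.
move=> c0; case on: (oddz n); first by rewrite edge_odd.
rewrite /edge; have := ruler_even_gt0 c0 (negbT on).
case: ruler => //= r _; by case: (r %% 3)%N => [|[]].
Qed.

(** The cyclic order of the labels matches the recursion b, c, d on the half 1. *)
Lemma label_shift s j : s != La -> (0 < j)%N ->
  active s (label j.+1) = active (odflt La (letter_sec s true)) (label j).
Proof.
case: j => // j sa _; rewrite /label -addn1 -modnDml.
by case: s sa => // _; have := ltn_pmod j (isT : 0 < 3)%N; case: (j %% 3)%N => [|[|[|]]].
Qed.

(** The self-similarity of the line. The even edge 2 k joins the pairs k and
    k + 1. For k odd it is labelled d and sits in the half 0, where b and c
    act as a, and a acts along the odd edge k. For k even it sits in the half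
    1, where the section of a letter is active on the edge k exactly when the
    letter is active on 2 k. *)
Lemma walk1_address c s N n : (0 < c)%N ->
  address N (walk1 (edge c) s n) = letter_act s (address N n).
Proof.
elim: N c s n => // N IH c s n c0.
rewrite [address _.+1 n]/= letter_act_cons.
have act1 o k : act (oseq o) (address N k) =
    address N (if o is Some t then walk1 (edge c.+2) t k else k).
  by case: o => //= t; rewrite IH.
rewrite act1 {act1}.
have [k [->|->]] := int_half n; rewrite ?block_even ?block_odd ?oddz_even ?oddz_odd.
- rewrite /walk1 (edge_odd c (oddz_odd k)).
  have [->|sa] := eqVneq s La.
    rewrite /active /= edge_eqLa// oddz_even/= block_odd oddz_odd.
    by case: (oddz k).
  rewrite (_ : active s La = false); last by rewrite /active (negbTE sa).
  rewrite edge_even //.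
  have step b : address N.+1 (if b then 2 * k + 1 else 2 * k) =
      (false == oddz k) :: address N (if b then k + 1 else k).
    case: b => /=; last by rewrite block_even oddz_even.
    rewrite (_ : 2 * k + 1 = 2 * (k + 1) - 1); last by lia.
    by rewrite block_odd oddz_odd oddzS; case: (oddz k).
  rewrite step addbF; congr (_ :: address _ _).
  case ok: (oddz k) => /=.
    rewrite (ruler_odd _ ok) /=.
    by case: s sa => //= _; rewrite edge_odd.
  rewrite label_shift ?ruler_even_gt0 ?ok// -/(edge _ _).
  case: s sa => //= _; rewrite (@edge_odd _ (k - 1)) ?oddzB1 ?ok//;
  by rewrite {2}/active.
- rewrite /walk1 (edge_odd c (oddz_odd k)).
  have [->|sa] := eqVneq s La.
    rewrite /active /= subrK block_even oddz_even.
    by case: (oddz k).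
  rewrite (_ : active s La = false); last by rewrite /active (negbTE sa).
  rewrite (_ : 2 * k - 1 - 1 = 2 * (k - 1)); last by lia.
  rewrite edge_even //.
  have step b : address N.+1 (if b then 2 * (k - 1) else 2 * k - 1) =
      (true == oddz k) :: address N (if b then k - 1 else k).
    case: b => /=; last by rewrite block_odd oddz_odd.
    by rewrite block_even oddz_even oddzB1; case: (oddz k).
  rewrite step addbF; congr (_ :: address _ _).
  case ok: (oddz k) => /=.
    rewrite label_shift ?ruler_even_gt0 ?oddzB1 ?ok// -/(edge _ _).
    by case: s sa => //= _; rewrite (edge_odd _ ok) {2}/active.
  rewrite (@ruler_odd _ (k - 1)) ?oddzB1 ?ok //=.
  by case: s sa => //= _; rewrite !active_La !edge_eqLa// oddzB1 ok.
Qed.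

Lemma walk_address c w N n : (0 < c)%N ->
  address N (walk (edge c) w n) = act w (address N n).
Proof. by move=> c0; elim: w => //= s w IH; rewrite walk1_address// IH. Qed.

Lemma address_surj u : exists n, address (size u) n = u.
Proof.
elim: u => [|e u [k ku]]; first by exists 0.
exists (if e == oddz k then 2 * k - 1 else 2 * k) => /=.
case ek: (e == oddz k); rewrite ?block_odd ?oddz_odd ?block_even ?oddz_even ku;
by move: ek; case: (e); case: (oddz k).
Qed.

(** Addresses of length N fold the line onto a segment of 2 ^ N vertices, of
    which this interval is a fundamental domain. *)
Lemma address_inj N (n m : int) : 0 < n <= 2 ^+ N -> 0 < m <= 2 ^+ N ->
  address N n = address N m -> n = m.
Proof.
elim: N n m => [|N IH] n m; first by rewrite expr0; lia.
rewrite exprS; have [k nE] := int_half n; have [l mE] := int_half m.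
case: nE => ->; case: mE => -> hn hm /= [];
rewrite ?block_odd ?oddz_odd ?block_even ?oddz_even => par /IH kl;
by move: par; rewrite kl; [case: (oddz l)|lia|lia].
Qed.

Lemma walk_dist x w n : `|walk x w n - n| <= (size w)%:Z.
Proof.
elim: w => [|s w IH] /=; first by rewrite subrr.
by rewrite {1}/walk1; case: ifP => _; [|case: ifP => _]; lia.
Qed.

(** From such a vertex the walk stays among positive vertices, where addresses
    separate points. Near 0 they do not: n and 1 - n have the same addresses. *)
Lemma triv_walk c w n : (0 < c)%N -> triv w -> (size w)%:Z < n ->
  walk (edge c) w n = n.
Proof.
move=> c0 tw lt; have := walk_dist (edge c) w n; set m := walk _ _ _ => dist.
have [N hN] : exists N, (`|n| + `|m| <= 2 ^ N)%N.
  by exists (`|n| + `|m|)%N; apply: ltnW; exact: ltn_expl.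
have hN' : n <= 2 ^+ N /\ m <= 2 ^+ N by rewrite -natrX; lia.
apply: (@address_inj N); try lia.
by rewrite walk_address// tw.
Qed.

Lemma ruler_odd_part (n : int) : n != 0 ->
  exists (j : nat) (r : int), n = 2 ^+ j * (2 * r + 1).
Proof.
move=> n0; exists (logn 2 `|n|%N).
have [] := @pfactor_coprime 2 `|n|%N isT; first by rewrite absz_gt0.
move=> m; rewrite coprime2n => om nE.
have nE' : `|n| = m%:Z * 2 ^+ logn 2 `|n|%N by rewrite -natrX; lia.
have [k mk] : exists k, m = k.*2.+1.
  by exists m./2; rewrite -[LHS]odd_double_half om.
move: nE'; rewrite mk; set q := _ ^+ _ => nE'.
have [n_ge0|n_lt0] := lerP 0 n; [exists k%:Z|exists (- k%:Z - 1)]; nia.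
Qed.

Lemma rulerE c (j : nat) (r : int) : ruler c (2 ^+ j * (2 * r + 1)) = j.
Proof.
have r0 : 2 * r + 1 != 0 by lia.
rewrite /ruler mulf_eq0 (negbTE r0) orbF expf_eq0 andbF.
rewrite abszM lognM ?absz_gt0 ?expf_neq0// abszX pfactorK//.
have : ruler 0 (2 * r + 1) = 0%N by apply: ruler_odd; rewrite /oddz; lia.
by rewrite /ruler (negbTE r0) => ->; rewrite addn0.
Qed.

Definition ruler_seq := edge 1.

(** Adding an odd multiple of 2 ^ (3 R + 1) preserves the valuation of every
    nonzero i in the window and moves 0 to valuation 3 R + 1, whose label is
    the one put at 0 since it is 1 modulo 3. *)
Lemma ruler_seq_recurrent (R : nat) : exists2 P : nat, (0 < P)%N &
  forall i m : int, `|i| <= R%:Z -> ruler_seq (i + P%:Z * (2 * m + 1)) = ruler_seq i.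
Proof.
exists (2 ^ (3 * R).+1)%N => [|i m iR]; first by rewrite expn_gt0.
rewrite -(natz (2 ^ _)%N) natrX /ruler_seq /edge; have [->|i0] := eqVneq i 0.
  by rewrite add0r rulerE /ruler/= mulnC modnMl.
have [j [r iE]] := ruler_odd_part i0; congr label.
have jR : (j < (3 * R).+1)%N.
  have : (2 ^ j <= R)%N.
    have := iR; rewrite iE normrM normrX => le1.
    have : 1 <= `|2 * r + 1| by lia.
    have q0 : 0 <= 2 ^+ j :> int by exact: exprn_ge0.
    move: le1; rewrite -lez_nat -(natz (2 ^ _)%N) natrX (_ : `|2| = 2 :> int)//.
    by move: q0; set q := 2 ^+ j; nia.
  by have := ltn_expl j (isT : 1 < 2)%N; lia.
rewrite [in RHS]iE rulerE iE.
rewrite [X in ruler _ X](_ : _ = 2 ^+ j * (2 * (r + 2 ^+ (3 * R - j) * (2 * m + 1)) + 1)).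
  by rewrite rulerE.
have -> : (3 * R).+1 = (j + (3 * R - j).+1)%N by lia.
by rewrite exprD exprS; set a := 2 ^+ j; set b := 2 ^+ _; nia.
Qed.

(** If p has valuation j, then 2 ^ (j + 1) - p has valuation j while its
    translate by p has valuation j + 1, and consecutive valuations carry
    different labels. *)
Lemma ruler_seq_aperiodic (p : int) : p != 0 -> exists n, ruler_seq (n + p) != ruler_seq n.
Proof.
move=> /ruler_odd_part[j [r pE]]; exists (2 ^+ j.+1 - p).
rewrite subrK /ruler_seq /edge pE
  [X in _ != label (ruler _ X)](_ : _ = 2 ^+ j * (2 * (- r) + 1)); last first.
  by rewrite exprS; nia.
rewrite -[2 ^+ j.+1]mulr1 -[X in _ * X](_ : 2 * 0 + 1 = 1)// !rulerE.
case: j {pE} => // j; rewrite /label -addn1 -modnDml.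
by have := ltn_pmod j (isT : 0 < 3)%N; case: (j %% 3)%N => [|[|[|]]].
Qed.

Lemma ruler_seq_alternates n : (ruler_seq n == La) != (ruler_seq (n + 1) == La).
Proof. by rewrite /ruler_seq !edge_eqLa// oddzS; case: oddz. Qed.

End Line.

(** * Torsion sections of elementary amenable groups *)

Definition subgroup_mem (G : groupType) (K : subgroup G) : G -> Prop :=
  subgroup_set K.
Coercion subgroup_mem : subgroup >-> Funclass.

Section ElementaryAmenability.
Local Open Scope group_scope.

Section SubgroupOps.
Variable G : groupType.
Implicit Types K M : subgroup G.

Lemma sgV K x : K x -> K x^-1.
Proof. by move=> Kx; rewrite -div1g; apply: subgroupF => //; exact: subgroup1. Qed.

Lemma sgM K x y : K x -> K y -> K (x * y).
Proof. by move=> Kx Ky; rewrite -[y]invgK; apply: subgroupF => //; exact: sgV. Qed.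

Lemma sgX K x n : K x -> K (x ^+ n).
Proof.
move=> Kx; elim: n => [|n IH]; first exact: subgroup1.
by rewrite expgS; exact: sgM.
Qed.

(** Products without inverses suffice: in a torsion section the inverse of s is
    a power of s. *)
Inductive spanned (S : seq G) : G -> Prop :=
| spanned1 : spanned S 1
| spannedM g s : spanned S g -> s \in S -> spanned S (g * s).

Lemma spanned_mul S g h : spanned S g -> spanned S h -> spanned S (g * h).
Proof.
move=> Sg; elim=> [|h' s _ IH sS]; first by rewrite mulg1.
by rewrite mulgA; exact: spannedM.
Qed.

Lemma spanned_mem S s : s \in S -> spanned S s.
Proof. by move=> /(spannedM (spanned1 S)); rewrite mul1g. Qed.

Lemma spanned_sub S K g : (forall s, s \in S -> K s) -> spanned S g -> K g.
Proof.
move=> SK; elim=> [|h s _ Kh /SK Ks]; first exact: subgroup1.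
exact: sgM.
Qed.

(** Sections K / M are handled as pairs of subgroups of the ambient group, which
    makes images and preimages under morphisms immediate. *)
Definition torsion_section K M :=
  [/\ M `<=` K, forall k m, K k -> M m -> M (k * m * k^-1) &
      forall k, K k -> exists2 n, (0 < n)%N & M (k ^+ n)].

(** Every torsion section K / M is locally finite: the span of a finite subset
    of K meets finitely many cosets of M. This property passes through all
    the operations that build elementary amenable groups. *)
Definition locally_finite_sections :=
  forall K M, torsion_section K M -> forall S : seq G, (forall s, s \in S -> K s) ->
  exists T : seq G, forall g, spanned S g -> exists2 t, t \in T & M (g / t).

End SubgroupOps.

Section MultiplicativeGroups.
Variables (H G : groupType) (f : {multiplicative H -> G}).

Lemma hom1 : f 1 = 1.
Proof. by apply: (mulgI (f 1)); rewrite -gmulfM !mulg1. Qed.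

Lemma homV x : f x^-1 = (f x)^-1.
Proof. by apply: (mulgI (f x)); rewrite -gmulfM !mulgV hom1. Qed.

Lemma homF x y : f (x / y) = f x / f y.
Proof. by rewrite gmulfM homV. Qed.

Lemma homX x n : f (x ^+ n) = f x ^+ n.
Proof. by elim: n => [|n IH]; rewrite ?hom1// !expgS gmulfM IH. Qed.

End MultiplicativeGroups.

Section Morphism.
Variables (H G : groupType) (f : {multiplicative H -> G}).

Lemma preim_subgroup1 (K : subgroup G) : (f @^-1` K) 1.
Proof. by change (K (f 1)); rewrite hom1; exact: subgroup1. Qed.

Lemma preim_subgroupF (K : subgroup G) x y :
  (f @^-1` K) x -> (f @^-1` K) y -> (f @^-1` K) (x / y).
Proof. by move=> Kx Ky; change (K (f (x / y))); rewrite homF; exact: subgroupF. Qed.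

Definition preim_subgroup K := Subgroup (preim_subgroup1 K) (@preim_subgroupF K).

Lemma image_subgroup1 (K : subgroup H) : (f @` K) 1.
Proof. by exists 1; [exact: subgroup1|by rewrite hom1]. Qed.

Lemma image_subgroupF (K : subgroup H) x y :
  (f @` K) x -> (f @` K) y -> (f @` K) (x / y).
Proof.
move=> [a Ka <-] [b Kb <-]; exists (a / b); first exact: subgroupF.
by rewrite homF.
Qed.

Definition image_subgroup K := Subgroup (image_subgroup1 K) (@image_subgroupF K).

Lemma preim_torsion_section K M : torsion_section K M ->
  torsion_section (preim_subgroup K) (preim_subgroup M).
Proof.
move=> [MK nM tK]; split=> [x|k m Kk Mm|k /tK[n n0 Mkn]]; first exact: MK.
  by change (M (f (k * m * k^-1))); rewrite !gmulfM homV; exact: nM.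
by exists n => //; change (M (f (k ^+ n))); rewrite homX.
Qed.

Lemma image_torsion_section K M : torsion_section K M ->
  torsion_section (image_subgroup K) (image_subgroup M).
Proof.
move=> [MK nM tK]; split=> [_ [x /MK Kx <-]|_ _ [k Kk <-] [m Mm <-]|_ [k Kk <-]].
- by exists x.
- by exists (k * m * k^-1); [exact: nM|rewrite !gmulfM homV].
- by have [n n0 Mkn] := tK _ Kk; exists n => //; exists (k ^+ n); rewrite ?homX.
Qed.

Lemma spanned_map S g : spanned (map f S) g ->
  exists2 h, spanned S h & f h = g.
Proof.
elim=> [|g' _ _ [h Sh <-] /mapP[s sS ->]].
  by exists 1; [exact: spanned1|by rewrite hom1].
by exists (h * s); [exact: spannedM|rewrite gmulfM].
Qed.

Lemma map_spanned S h : spanned S h -> spanned (map f S) (f h).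
Proof.
elim=> [|h' s _ IH sS]; first by rewrite hom1; exact: spanned1.
by rewrite gmulfM; apply: spannedM => //; exact: map_f.
Qed.

Lemma sections_of_image K M S : locally_finite_sections H ->
  torsion_section K M -> (forall s, s \in map f S -> K s) ->
  exists T : seq G, forall g, spanned (map f S) g ->
    exists2 t, t \in T & M (g / t).
Proof.
move=> lfH /preim_torsion_section KM SK.
have [s sS|T hT] := lfH _ _ KM S; first by apply: SK; exact: map_f.
exists (map f T) => g /spanned_map[h /hT[t tT Mht] <-].
by exists (f t); [exact: map_f|rewrite -homF].
Qed.

End Morphism.

Lemma finite_sections (G : groupType) :
  finite_set [set: G] -> locally_finite_sections G.
Proof.
move=> /finite_seqP[T GT] K M _ S _; exists T => g _; exists g.
  by have : [set: G] g by []; rewrite GT.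
by rewrite divgg; exact: subgroup1.
Qed.

(** In the span of s and S the exponent of s only matters modulo the order of s. *)
Lemma abelian_sections (G : groupType) :
  (forall x y : G, x * y = y * x) -> locally_finite_sections G.
Proof.
move=> mulC K M [MK _ tK]; elim=> [_|s S IH SK].
  exists [:: 1] => g; elim=> // {g}; exists 1; rewrite ?mem_head// divgg.
  exact: subgroup1.
have [t tS|T hT] := IH; first by apply: SK; rewrite inE tS orbT.
have [n n0 Msn] := tK _ (SK s (mem_head _ _)).
exists [seq t * s ^+ (j : nat) | t <- T, j <- iota 0 n] => g Sg.
have [a [h Sh ->]] : exists a, exists2 h, spanned S h & g = h * s ^+ a.
  elim: Sg => [|h x _ [a [h' Sh' ->]]].
    by exists 0%N, 1; [exact: spanned1|rewrite mulg1].
  rewrite inE => /predU1P[->|xS]; first by exists a.+1, h' => //; rewrite expgSr mulgA.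
  by exists a, (h' * x); [exact: spannedM|rewrite -!mulgA (mulC _ x)].
have [t tT Mht] := hT _ Sh.
exists (t * s ^+ (a %% n)%N).
  by apply: allpairs_f => //; rewrite mem_iota /= add0n ltn_pmod.
rewrite {1}(divn_eq a n) expgnDr mulnC expgnA invgM !mulgA mulgK.
rewrite -mulgA (mulC _ t^-1) mulgA; apply: sgM => //.
exact: sgX.
Qed.

(** Schreier's argument. The section of Q gives a finite set T of representatives
    of the span of S modulo M i(N). For t in T and s in S, write t s as an
    element of M times i (k t s) times a representative; then the span of S
    lies in M i(U') T, where U' is the span of the finite set U of all k t s,
    and the section of N makes U' finite modulo M. *)
Lemma extension_sections (N G Q : groupType)
    (i : {multiplicative N -> G}) (p : {multiplicative G -> Q}) :
    (forall g, p g = 1 <-> exists n, i n = g) ->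
  locally_finite_sections N -> locally_finite_sections Q ->
  locally_finite_sections G.
Proof.
move=> ker lfN lfQ K M KM S SK; have [MK nM tK] := KM.
have [q qS|TQ hTQ] := lfQ _ _ (image_torsion_section p KM) (map p S).
  by move/mapP: qS => [s sS ->]; exists s => //; exact: SK.
(* Representatives, chosen in the span of S, of its cosets modulo M i(N). *)
pose rep q := xget 1 [set g | spanned S g /\ image_subgroup p M (p g / q)].
pose T := 1 :: map rep TQ.
have TS t : t \in T -> spanned S t.
  rewrite inE => /predU1P[->|/mapP[q _ ->]]; first exact: spanned1.
  rewrite /rep; case: xgetP => [g _ []//|_]; exact: spanned1.
have hT g : spanned S g -> exists2 t, t \in T & exists n, M (g / t / i n).
  move=> Sg; have [q qT Mq] := hTQ _ (map_spanned p Sg).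
  exists (rep q); first by rewrite inE map_f ?orbT.
  have [Sr [m' Mm' pm']] : spanned S (rep q) /\ image_subgroup p M (p (rep q) / q).
    by rewrite /rep; case: xgetP => [r _ //|/(_ g)]; case.
  case: Mq => m Mm pm.
  have /ker[n nE] : p (m' / m * (g / rep q)) = 1.
    by rewrite !(gmulfM, homV) pm' pm invgM invgK !mulgA !mulgVK mulgV.
  exists n; rewrite nE !invgM !invgK !mulgA mulgVK mulgV mul1g.
  exact: subgroupF.
pose k t s := xget 1 [set n | exists2 t', t' \in T & M (t * s / t' / i n)].
pose U := [seq k t s | t <- T, s <- S].
have Sk t s : t \in T -> s \in S ->
    exists2 t', t' \in T & M (t * s / t' / i (k t s)).
  move=> tT sS; have [t' t'T [n Mn]] := hT _ (spannedM (TS _ tT) sS).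
  by rewrite /k; case: xgetP => [x _ //|/(_ n)]; case; exists t'.
have KS g : spanned S g -> K g by exact: spanned_sub.
have KU u : u \in U -> preim_subgroup i K u.
  move=> /allpairsP[[t s] /= [tT sS ->]]; have [t' t'T Mk] := Sk _ _ tT sS.
  change (K (i (k t s))).
  have -> : i (k t s) = (t * s / t' / i (k t s))^-1 * (t * s / t').
    by rewrite invgM invgK mulgVK.
  apply: sgM; first by apply: sgV; exact: MK.
  apply: subgroupF; last exact/KS/TS.
  by apply: sgM; [exact/KS/TS|exact: SK].
have [T2 hT2] := lfN _ _ (preim_torsion_section i KM) U KU.
exists [seq i t2 * t | t2 <- T2, t <- T] => g Sg.
have [t tT [u Uu Mg]] : exists2 t, t \in T & exists2 u, spanned U u & M (g / t / i u).
  elim: Sg => [|h s _ [t tT [u Uu Mh]] sS].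
    exists 1; rewrite ?mem_head//; exists 1; first exact: spanned1.
    by rewrite hom1 !divg1; exact: subgroup1.
  have [t' t'T Mk] := Sk _ _ tT sS; exists t' => //.
  have ku : k t s \in U by exact: allpairs_f.
  exists (u * k t s); first exact: spannedM.
  have Ku : K (i u) by exact: (spanned_sub KU Uu).
  have := sgM Mh (nM _ _ Ku Mk).
  by rewrite gmulfM invgM !mulgA !mulgVK.
have [t2 t2T Mu] := hT2 _ Uu; exists (i t2 * t); first exact: allpairs_f.
move: Mu; change (M (i (u / t2)) -> M (g / (i t2 * t))); rewrite homF => Mu.
by have := sgM Mg Mu; rewrite invgM !mulgA mulgVK.
Qed.

Lemma subgroup_sections (H G : groupType) (i : {multiplicative H -> G}) :
  injective i -> locally_finite_sections G -> locally_finite_sections H.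
Proof.
move=> injf lfG K M KM S SK.
have [g|T hT] := lfG _ _ (image_torsion_section i KM) (map i S).
  by move=> /mapP[s sS ->]; exists s => //; exact: SK.
pose pre t := xget 1 [set h | i h = t].
exists (map pre T) => h Sh; have [t tT [m Mm hm]] := hT _ (map_spanned i Sh).
exists (pre t); first exact: map_f.
rewrite (_ : h / pre t = m)//; apply: injf; rewrite homF hm; congr (_ / _).
rewrite /pre; case: xgetP => [//|/(_ (m^-1 * h))] []; rewrite /= gmulfM homV hm.
by rewrite invgM invgK mulgVK.
Qed.

Lemma lift_seq (H G : groupType) (f : {multiplicative H -> G}) (S : seq G) :
  (forall s, exists h, f h = s) -> exists S', map f S' = S.
Proof.
move=> sf; elim: S => [|s S [S' <-]]; first by exists [::].
by have [h <-] := sf s; exists (h :: S').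
Qed.

Lemma quotient_sections (G Q : groupType) (p : {multiplicative G -> Q}) :
  (forall q, exists g, p g = q) ->
  locally_finite_sections G -> locally_finite_sections Q.
Proof.
move=> sp lfG K M KM S; have [S' <-] := lift_seq S sp.
exact: sections_of_image.
Qed.

(** A finite set already comes from one group of the system. *)
Lemma limit_sections (D : directed_system) (G : groupType)
    (c : forall i, {multiplicative ds_group D i -> G}) :
  inductive_limit c -> (forall i, locally_finite_sections (ds_group D i)) ->
  locally_finite_sections G.
Proof.
move=> [cmap csurj _] lfD K M KM S.
have [i [S' <-]] : exists i S', map (c i) S' = S; last exact: sections_of_image.
elim: S => [|s S [i [S' <-]]]; first by have [i _] := csurj 1; exists i, [::].
have [j [x <-]] := csurj s; have [k [ik jk]] := ds_directed i j.
exists k, (ds_map jk x :: map (ds_map ik) S').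
by rewrite /= cmap -map_comp; congr (_ :: _); apply: eq_map => y /=; rewrite cmap.
Qed.

Lemma elementary_amenable_sections (G : groupType) :
  elementary_amenable G -> locally_finite_sections G.
Proof.
elim=> {G}.
- exact: finite_sections.
- exact: abelian_sections.
- by move=> N G Q i p _ _ ker _ lfN _ lfQ; exact: (extension_sections ker lfN lfQ).
- by move=> D G c lim _ lfD; exact: (limit_sections lim lfD).
- by move=> H G i inji _ lfG; exact: (subgroup_sections inji lfG).
- by move=> G Q p surjp _ lfG; exact: (quotient_sections surjp lfG).
Qed.

Section TorsionGenerated.
Variable G : groupType.
Hypothesis torG : torsion_group G.

Lemma spannedF (S : {fset G}) x y : spanned S x -> spanned S y -> spanned S (x / y).
Proof.
move=> Sx Sy; have [[//|n] _ yn] := torG y.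
have -> : y^-1 = y ^+ n by apply: (mulIg y); rewrite mulVg -expgSr.
apply: spanned_mul => //; elim: n {yn} => [|n IH]; first exact: spanned1.
by rewrite expgS; exact: spanned_mul.
Qed.

Lemma generating_spanned (S : {fset G}) g : generating_set S -> spanned S g.
Proof.
pose K := Subgroup (spanned1 S) (@spannedF S) => /(_ K) gS.
by change ((K : set G) g); rewrite gS// => s; exact: spanned_mem.
Qed.

Lemma trivial_subgroupF x y : [set 1 : G] x -> [set 1] y -> [set 1] (x / y).
Proof. by move=> -> ->; rewrite /= divgg. Qed.

Lemma torsion_elementary_amenable_finite :
  finitely_generated G -> elementary_amenable G -> finite_set [set: G].
Proof.
move=> [S genS] /elementary_amenable_sections lfG.
pose top := @Subgroup G [set: G] I (fun _ _ _ _ => I).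
pose bot := @Subgroup G [set 1] (erefl 1) trivial_subgroupF.
have [|//|T hT] := lfG top bot _ S.
  split=> // [k m _ ->|k _]; first by rewrite /= mulg1 mulgV.
  by have [n n0 kn] := torG k; exists n.
apply: (@sub_finite_set _ _ [set` T]); last by apply/finite_seqP; exists T.
move=> g _ /=; have [t tT] := hT g (generating_spanned g genS).
by move=> /divg1_eq ->.
Qed.
End TorsionGenerated.
End ElementaryAmenability.

(** * Topology of subshifts *)

Section Subshifts.
Local Open Scope ring_scope.

Section Windows.
Variable A : finType.

Definition agree (R : nat) (x y : int -> A) :=
  forall i : int, `|i| <= R%:Z -> x i = y i.

Lemma agreeW R R' x y : (R' <= R)%N -> agree R x y -> agree R' x y.
Proof. by move=> le xy i iR; apply: xy; lia. Qed.

Lemma nbhs_full_shift (x : full_shift A) U :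
  nbhs x U <-> exists R, forall y : full_shift A, agree R x y -> U y.
Proof.
split; last first.
  move=> [R RU]; suff xR : nbhs x (agree R x : set (full_shift A)) by exact: filterS RU xR.
  have near1 (i : int) : nbhs x [set y : full_shift A | y i = x i].
    exact: (@proj_continuous int (fun=> discrete_topology A) i x [set x i] (discrete_set1 _)).
  elim: R {RU} => [|R IH].
    by have := near1 0; apply: filterS => y /= xy i i0; rewrite (_ : i = 0) ?xy//; lia.
  refine (filterS _ (filterI IH (filterI (near1 R.+1%:Z) (near1 (- R.+1%:Z))))).
  move=> y /= [xy [yR yR']] i iR.
  have [iR'|[->|->]] : `|i| <= R%:Z \/ (i = R.+1%:Z \/ i = - R.+1%:Z) by lia.
  - exact: xy.
  - by rewrite yR.
  - by rewrite yR'.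
pose F := filter_from [set: nat] (fun R => [set y : full_shift A | agree R x y]).
have FF : Filter F.
  apply: filter_from_filter; first by exists 0%N.
  move=> R R' _ _; exists (maxn R R') => // y xy.
  by split; apply: agreeW xy; rewrite ?leq_maxl ?leq_maxr.
suff : F --> x by move=> + xU => /(_ _ xU)[R _ RU]; exists R.
apply: (iffRL (@pointwise_cvgP (discrete_topology int) (discrete_topology A) F x FF)) => i V xV.
exists `|i|%N => // y xy; rewrite /= -xy; first exact: nbhs_singleton.
by lia.
Qed.

End Windows.

Section SubshiftTopology.
Variables (A : finType) (X : subshift A).
Implicit Types x y : X.

Lemma nbhs_subshift x (U : set X) :
  nbhs x U <-> exists R, forall y, agree R (val x) (val y) -> U y.
Proof.
split=> [[_ [[W oW <-] Wx WU]]|[R RU]].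
  have /nbhs_full_shift[R RW] : nbhs (val x : full_shift A) W.
    exact: open_nbhs_nbhs.
  by exists R => y /RW/WU.
have xR : nbhs (val x : full_shift A) [set z | agree R (val x) z].
  by apply/nbhs_full_shift; exists R.
have xR' : nbhs x [set y | agree R (val x) (val y)].
  exact: (@initial_continuous X (full_shift A) set_val x _ xR).
by refine (filterS _ xR').
Qed.

Lemma subshift_compact : compact [set: X].
Proof.
have cX : compact (X : set (full_shift A)).
  apply: (@subclosed_compact _ _ [set: full_shift A]) => //; last first.
    have fin : compact [set: discrete_topology A].
      by apply: finite_compact; exact: (@finite_finset A setT).
    have := @tychonoff int (fun=> discrete_topology A) _ (fun=> fin).
    by congr (compact _); rewrite eqEsubset.
  exact: subshift_closed.
move=> F PF _; have FX : F (set_val @^-1` X).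
  by refine (filterS _ (@filterT _ F _)) => x _; exact: set_valP.
have [p [Xp cp]] := cX (set_val @ F) _ FX.
exists (exist _ p (mem_set Xp)); split=> // B U FB /nbhs_subshift[R RU].
have Fv : F (set_val @^-1` (set_val @` B)).
  by refine (filterS _ FB) => x Bx; exists x.
have pR : nbhs (p : full_shift A) [set z | agree R p z].
  by apply/nbhs_full_shift; exists R.
have [z [[y By <-] pz]] := cp _ _ Fv pR.
by exists y; split => //; exact: RU.
Qed.

Lemma coordinate_clopen (i : int) (a : A) : clopen [set x : X | val x i = a].
Proof.
have loc x y : agree `|i|%N (val x) (val y) -> val y i = val x i.
  by move=> ->//; lia.
split.
  rewrite openE => x xa; apply/nbhs_subshift; exists `|i|%N => y /loc yx.
  exact: etrans yx xa.
move=> x cx; have xi : nbhs x [set y : X | val y i = val x i].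
  by apply/nbhs_subshift; exists `|i|%N => y /loc.
have [y [ya yx]] := cx _ xi; exact: etrans (esym yx) ya.
Qed.

Lemma subshift_separated x y : x != y -> exists i, val x i != val y i.
Proof.
move=> xy; apply: contrapT => /forallNP h; move/eqP: xy; apply.
by apply/val_inj/funext => i; apply/eqP; move: (h i) => /negP; rewrite negbK.
Qed.

Lemma subshift_zero_dimensional : zero_dimensional X.
Proof.
move=> x y /subshift_separated[i xyi]; exists [set z : X | val z i = val x i].
split=> //; first exact: coordinate_clopen.
by move=> /= /esym/eqP; rewrite (negbTE xyi).
Qed.

Lemma zero_dimensional_hausdorff (T : topologicalType) :
  zero_dimensional T -> hausdorff_space T.
Proof.
move=> zT; rewrite open_hausdorff => x y /zT[U [[oU cU] Ux Uy]].
exists (U, ~` U); first by rewrite !inE.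
by split=> //=; [exact: closed_openC|rewrite setICr].
Qed.

Lemma continuous_subshift (f : X -> X) :
  (forall R x, exists R', forall y, agree R' (val x) (val y) ->
     agree R (val (f x)) (val (f y))) -> continuous f.
Proof.
move=> cf x U /nbhs_subshift[R RU]; have [R' R'R] := cf R x.
by apply/nbhs_subshift; exists R' => y /R'R/RU.
Qed.

Lemma closed_continuous_inverse (S T : topologicalType) (f : S -> T) (g : T -> S) :
  cancel f g -> cancel g f -> (forall C, closed C -> closed (f @` C)) ->
  continuous g.
Proof.
move=> fK gK clf; apply/continuous_closedP => C /clf.
suff -> : f @` C = g @^-1` C by [].
rewrite eqEsubset; split=> [_ [x Cx <-]|y Cy]; first by rewrite /= fK.
by exists (g y).
Qed.

Lemma subshift_perfect :
  (forall (x : X) n, exists2 y : X, agree n (val x) (val y) & x != y) ->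
  perfect_set [set: X].
Proof.
move=> perf; apply/perfectTP_ex => U oU [x Ux].
have /nbhs_subshift[n nU] : nbhs x U by exact: open_nbhs_nbhs.
by have [y xy xny] := perf x n; exists x, y; split => //; exact: nU.
Qed.

Lemma cantor_like_homeomorphism (R : realType) (T : pseudoPMetricType R) :
  cantor_like T -> inhabited (homeomorphism T cantor_space).
Proof.
move=> /(@homeomorphism_cantor_like R)[f [cf clf]].
have fK : cancel f (f^-1)%FUN by move=> x; apply: funK; rewrite inE.
have gK : cancel (f^-1)%FUN f by move=> x; apply: invK; rewrite inE.
exact: (inhabits (Homeomorphism gK fK (closed_continuous_inverse fK gK clf) cf)).
Qed.

Lemma subshift_cantor (R : realType) :
  (forall (x : X) n, exists2 y : X, agree n (val x) (val y) & x != y) -> X ->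
  inhabited (homeomorphism X cantor_space).
Proof.
move=> perf z0.
(* Countable products of discrete spaces are pseudometrizable, hence so is X;
   T is X with such a pseudometric, which induces the given topology. *)
pose Y : pseudoMetricType R :=
  (X : set (prod_topology (fun _ : int => discrete_topology A))) : Type.
pose T : pseudoPMetricType R := HB.pack (Y : Type) (PseudoMetric.class Y) (isPointed.Build Y z0).
have cT : cantor_like T.
  split.
  - exact: subshift_perfect.
  - exact: subshift_compact.
  - exact: (zero_dimensional_hausdorff subshift_zero_dimensional).
  - exact: subshift_zero_dimensional.
have := cantor_like_homeomorphism cT.
have -> : (T : topologicalType) = (X : topologicalType) by reflexivity.
exact.
Qed.

End SubshiftTopology.

Section ShiftPowers.
Variables (A : finType) (X : subshift A).

Lemma expgz_shift (n : int) (x : X) (i : int) :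
  val (expgz (subshift_map X) n x) i = val x (i + n).
Proof.
elim/int_rec: n x i => [|n IH|n IH] x i; first by rewrite addr0.
  by rewrite intS (addrC 1) expgzS homeoM IH /= /Defs.shift; congr (val x _); lia.
rewrite -{1}(sub_unshiftK x).
have -> : sub_shift (sub_unshift x) = subshift_map X (sub_unshift x) by [].
rewrite -homeoM -expgzS oppSD1 IH /= /unshift; congr (val x _); lia.
Qed.

Lemma subshift_minimal (R : realType) :
  (forall (x : X) n, exists2 y : X, agree n (val x) (val y) & x != y) -> X ->
  (forall (x y : X) n, exists m, agree n (val y) (fun i => val x (i + m))) ->
  minimal_subshift X.
Proof.
move=> perf z0 rec; split; [exact: subshift_compact|exact: (subshift_cantor R)|].
move=> x O [y Oy] oO; have /nbhs_subshift[n nO] : nbhs y O by exact: open_nbhs_nbhs.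
have [m ym] := rec x y n; exists (expgz (subshift_map X) m x); split; last by exists m.
by apply: nO => i ni; rewrite expgz_shift; exact: ym.
Qed.

End ShiftPowers.

(** * The ruler subshift and the Grigorchuk group in its full group *)

(** The orbit closure of the ruler sequence, described by finite windows. *)
Definition language (y : full_shift letter) :=
  forall R, exists n : int, agree R y (fun i => ruler_seq (i + n)).

Lemma language_closed : closed (language : set (full_shift letter)).
Proof.
move=> y cy R; have yR : nbhs (y : full_shift letter) [set z | agree R y z].
  by apply/nbhs_full_shift; exists R.
have [z [/(_ R)[n zn] yz]] := cy _ yR; exists n => i iR.
by rewrite yz// zn.
Qed.

Lemma language_translate k y : language y -> language (fun i => y (i + k)).
Proof.
move=> Ly R; have [n yn] := Ly (R + `|k|)%N; exists (n + k) => i iR /=.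
by rewrite yn; [congr (ruler_seq _)|]; lia.
Qed.

Lemma language_invariant :
  @Defs.shift letter @` (language : set (full_shift letter)) = language.
Proof.
rewrite eqEsubset; split=> [_ [y Ly <-]|y Ly]; first exact: language_translate.
exists (unshift y); last exact: unshiftK.
exact: (language_translate (-1)).
Qed.

Definition ruler_subshift : subshift letter := Subshift language_closed language_invariant.

Lemma language_orbit n : language (fun i => ruler_seq (i + n)).
Proof. by move=> R; exists n. Qed.

Definition orbit_point (n : int) : ruler_subshift :=
  exist (fun y : full_shift letter => y \in (ruler_subshift : set (full_shift letter)))
    (fun i => ruler_seq (i + n)) (mem_set (language_orbit n)).

Lemma ruler_subshift_language (x : ruler_subshift) : language (val x).
Proof. exact: set_valP. Qed.

(** The lower bound M keeps clear of the neighbourhood of 0, where a word that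
    acts trivially on binary words is not yet known to fix the vertices. *)
Lemma ruler_subshift_locate (x : ruler_subshift) R (M : int) :
  exists2 n, M <= n & agree R (val x) (fun i => ruler_seq (i + n)).
Proof.
have [n xn] := ruler_subshift_language x R; have [P P0 xP] := ruler_seq_recurrent (R + `|n|).
pose m := (`|n| + `|M|) : int.
exists (n + P%:Z * (2 * m + 1)) => [|i iR]; first by rewrite /m; nia.
by rewrite xn// addrA xP//; lia.
Qed.

(** A window of y sits in a central window of the ruler sequence, which recurs
    at all odd multiples of P; every long enough window of x contains such an
    occurrence. Two occurrences of the same window give distinct points of
    the orbit by aperiodicity, so there are no isolated points. *)
Lemma ruler_subshift_minimal (R : realType) : minimal_subshift ruler_subshift.
Proof.
apply: (subshift_minimal R); last 2 first.
- exact: (orbit_point 0).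
- move=> x y r; have [p yp] := ruler_subshift_language y r.
  have [P P0 xP] := ruler_seq_recurrent (r + `|p|).
  have [q xq] := ruler_subshift_language x (r + `|p| + P)%N.
  (* With this m, the odd multiple P (2 m + 1) is within P of q. *)
  pose m := (q %/ (2 * P%:Z))%Z.
  have mP : `|P%:Z * (2 * m + 1) - q| <= P%:Z.
    have := divz_eq q (2 * P%:Z); rewrite -/m.
    have := modz_ge0 q (_ : 2 * P%:Z != 0); have := ltz_pmod q (_ : 0 < 2 * P%:Z).
    by set rr := (_ %% _)%Z; move=> /(_ ltac:(lia)) h1 /(_ ltac:(lia)) h2 qE; nia.
  exists (P%:Z * (2 * m + 1) - q + p) => i ir.
  rewrite xq; last by lia.
  rewrite yp// -(xP _ m); last by lia.
  by congr (ruler_seq _); lia.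
- move=> x r; have [n xn] := ruler_subshift_language x r.
  have [P P0 xP] := ruler_seq_recurrent (r + `|n|).
  have [|k kP] := @ruler_seq_aperiodic P%:Z; first by lia.
  have agree_pt j : j = 0 \/ j = P%:Z -> agree r (val x) (val (orbit_point (n + j))).
    case=> -> i ir /=; rewrite xn//; first by rewrite addr0.
    by rewrite -(xP (i + n) 0); [congr (ruler_seq _)|]; lia.
  have [xE|] := eqVneq x (orbit_point (n + 0)); last first.
    by exists (orbit_point (n + 0)) => //; apply: agree_pt; left.
  exists (orbit_point (n + P%:Z)); first by apply: agree_pt; right.
  apply/eqP => xP'; move: xE; rewrite xP' => /(congr1 (fun y => val y (k - n))) /=.
  rewrite (_ : k - n + (n + P%:Z) = k + P%:Z); last by lia.
  by rewrite addr0 subrK; apply/eqP.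
Qed.

Lemma ruler_subshift_active (x : ruler_subshift) s i :
  active s (val x i) -> ~~ active s (val x (i + 1)).
Proof.
have [n xn] := ruler_subshift_language x (`|i| + 1)%N.
rewrite !xn; try lia; rewrite addrAC; have := ruler_seq_alternates (i + n).
by rewrite /active; case: (s == La); case: (ruler_seq _ == La); case: (ruler_seq _ == La).
Qed.

(** Since a-edges alternate with the others, a letter is active on at most one
    of the two edges at the origin, and the order of the tests is immaterial. *)
Definition letter_step s (x : ruler_subshift) : int :=
  if active s (val x 0) then 1 else if active s (val x (-1)) then -1 else 0.

Lemma letter_step_local s (x y : ruler_subshift) :
  agree 1 (val x) (val y) -> letter_step s y = letter_step s x.
Proof. by move=> xy; rewrite /letter_step !xy. Qed.

Lemma letter_step_walk s (x : ruler_subshift) (n : int) (y : ruler_subshift) :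
  val y = (fun i => val x (i + n)) -> n + letter_step s y = walk1 (val x) s n.
Proof.
move=> yE; rewrite /letter_step /walk1 yE add0r addrC [-1 + n]addrC.
by case: ifP => _; [rewrite addrC|case: ifP => _; rewrite ?add0r// addrC].
Qed.

Definition letter_move s (x : ruler_subshift) : ruler_subshift :=
  expgz (subshift_map ruler_subshift) (letter_step s x) x.

Lemma letter_moveE s (x : ruler_subshift) i : val (letter_move s x) i = val x (i + letter_step s x).
Proof. exact: expgz_shift. Qed.

Lemma letter_moveK s : involutive (letter_move s).
Proof.
move=> x; apply/val_inj/funext => i; rewrite !letter_moveE -addrA.
suff -> : letter_step s (letter_move s x) + letter_step s x = 0 by rewrite addr0.
rewrite {1}/letter_step !letter_moveE add0r; case ax: (active s (val x 0)).
  rewrite (_ : letter_step s x = 1); last by rewrite /letter_step ax.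
  by have := ruler_subshift_active ax; rewrite add0r addNr ax => /negbTE ->.
case bx: (active s (val x (- 1))).
  by rewrite (_ : letter_step s x = -1) ?bx//; rewrite /letter_step ax bx.
by rewrite (_ : letter_step s x = 0) ?addr0 ?ax ?bx//; rewrite /letter_step ax bx.
Qed.

Lemma letter_move_continuous s : continuous (letter_move s).
Proof.
apply: continuous_subshift => R x; exists R.+1 => y xy i iR.
have st : letter_step s y = letter_step s x by apply: letter_step_local; exact: agreeW xy.
rewrite !letter_moveE st xy//; rewrite /letter_step; case: ifP => _; [|case: ifP => _]; lia.
Qed.

Definition letter_homeo s : homeomorphism ruler_subshift ruler_subshift :=
  Homeomorphism (letter_moveK s) (letter_moveK s)
    (@letter_move_continuous s) (@letter_move_continuous s).

Lemma letter_homeo_full s : full_group_set (subshift_map ruler_subshift) (letter_homeo s).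
Proof.
exists (letter_step s); split=> [x U xU|//].
apply/nbhs_subshift; exists 1%N => y /letter_step_local; rewrite /= => ->.
exact: (@nbhs_singleton (discrete_topology int) _ _ xU).
Qed.

Definition word_homeo (w : seq letter) : homeomorphism ruler_subshift ruler_subshift :=
  foldr (fun s g => (letter_homeo s * g)%g) 1%g w.

Lemma word_homeo_cat w v : word_homeo (w ++ v) = (word_homeo w * word_homeo v)%g.
Proof. by elim: w => [|s w IH] /=; rewrite ?mul1g// IH mulgA. Qed.

(** A word translates x by the displacement of the walk that it prescribes. *)
Lemma word_homeoE w (x : ruler_subshift) i : val (word_homeo w x) i = val x (i + walk (val x) w 0).
Proof.
elim: w i => [|s w IH] i /=; first by rewrite addr0.
rewrite letter_moveE -(@letter_step_walk s x _ (word_homeo w x)); last exact/funext.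
by rewrite IH addrA [X in val x X]addrAC.
Qed.

Lemma walk_local x y w n : agree (size w) (fun i => x (n + i)) (fun i => y (n + i)) ->
  walk x w n = walk y w n.
Proof.
elim: w => //= s w IH xy; rewrite -IH => [|i iw]; last by apply: xy; lia.
have := walk_dist x w n; set k := walk x w n => kn.
have e1 : x k = y k by have := xy (k - n); rewrite (addrC n) subrK; apply; lia.
have e2 : x (k - 1) = y (k - 1).
  by have := xy (k - 1 - n); rewrite (addrC n) subrK; apply; lia.
by rewrite /walk1 e1 e2.
Qed.

Lemma walk_translate x w n k : walk (fun i => x (i + k)) w n + k = walk x w (n + k).
Proof.
elim: w => //= s w IH; rewrite -IH /walk1 [_ - 1 + k]addrAC.
by case: ifP => _; [|case: ifP => _]; rewrite // addrAC.
Qed.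

(** The part of x that the walk can see occurs in the ruler sequence far to the
    right of 0, where the walk returns to its starting point. *)
Lemma word_homeo_triv w : triv w -> word_homeo w = 1%g.
Proof.
move=> tw; apply: homeo_ext => x; apply/val_inj/funext => i; rewrite word_homeoE.
have [n nw xn] := ruler_subshift_locate x (size w) (size w).+1.
rewrite (@walk_local _ (fun i => ruler_seq (i + n))) => [|j jw]; last first.
  by rewrite add0r; exact: xn.
have := walk_translate ruler_seq w 0 n; rewrite add0r /ruler_seq triv_walk//.
by move=> /(canRL (addrK _)) ->; rewrite subrr addr0.
Qed.

(** By aperiodicity, a word acting trivially on the orbit of the ruler sequence
    fixes every vertex of the line, and every binary word is an address. *)
Lemma triv_word_homeo w : word_homeo w = 1%g -> triv w.
Proof.
move=> w1 u; have [n <-] := address_surj u.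
rewrite -(walk_address w _ n (isT : 0 < 1)%N); congr (address _ _).
apply/eqP; rewrite -subr_eq0; apply/negPn/negP => /ruler_seq_aperiodic[k /eqP]; apply.
have := congr1
  (fun g : homeomorphism ruler_subshift ruler_subshift => g (orbit_point n)) w1.
move=> /(congr1 (fun y : ruler_subshift => val y (k - n))).
rewrite word_homeoE /= subrK => <-; congr (ruler_seq _).
have := walk_translate ruler_seq w 0 n; rewrite add0r -/ruler_seq => <-; lia.
Qed.

Lemma word_homeo_eqact w v : word_homeo w = word_homeo v <-> eqact w v.
Proof.
have cancelr x : word_homeo (x ++ rev x) = 1%g.
  by apply: word_homeo_triv => u; rewrite act_cat -{1}[x]revK act_rev.
have -> : word_homeo w = word_homeo v <-> word_homeo (w ++ rev v) = 1%g.
  rewrite word_homeo_cat; split=> [->|wv]; first by rewrite -word_homeo_cat cancelr.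
  by apply: (mulIg (word_homeo (rev v))); rewrite wv -word_homeo_cat cancelr.
split=> [/triv_word_homeo wv u|wv]; last first.
  by apply: word_homeo_triv => u; rewrite act_cat wv -{1}[v]revK act_rev.
by rewrite -[in LHS](act_rev v u) -act_cat wv.
Qed.

Definition image_words : set (homeomorphism ruler_subshift ruler_subshift) := range word_homeo.

Lemma image_words1 : image_words 1%g. Proof. by exists [::]. Qed.

Lemma image_wordsF g h : image_words g -> image_words h -> image_words (g / h)%g.
Proof.
move=> [w _ <-] [v _ <-]; exists (w ++ rev v) => //.
rewrite word_homeo_cat; congr (_ * _)%g; apply: (mulgI (word_homeo v)).
rewrite mulgV -word_homeo_cat.
by apply: word_homeo_triv => u; rewrite act_cat -{1}[v]revK act_rev.
Qed.

Definition grigorchuk : subgroup (homeomorphism ruler_subshift ruler_subshift) :=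
  Subgroup image_words1 image_wordsF.

Lemma grigorchuk_full : grigorchuk `<=` full_group (subshift_map ruler_subshift).
Proof.
move=> _ [w _ <-]; elim: w => [|s w IH]; first exact: full_group1.
rewrite [word_homeo _]/= -[word_homeo w]invgK; apply: full_groupF; first exact: letter_homeo_full.
by rewrite -div1g; apply: full_groupF => //; exact: full_group1.
Qed.
End Subshifts.

(** * Subexponential coverings *)

(** Lists of words that reach every element of weight at most n; their sizes
    bound the growth function from above. *)
Definition covering (L : nat -> seq (seq letter)) :=
  forall n w, weight w <= n -> exists2 w', w' \in L n & eqact w w'.

Definition contracted n := (6 * n + 24) %/ 7.

(** An element is determined by its effect on the first bit and by its two
    sections, whose total weight is at most contracted n once the word has
    been reduced. *)
Lemma covering_step L : covering L -> exists2 L', covering L' &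
  forall n, size (L' n) = 2 * \sum_(i < (contracted n).+1)
    size (L i) * size (L (contracted n - i)).
Proof.
move=> cL.
pose pick (p : bool * (seq letter * seq letter)) : seq letter :=
  xget [::] [set w | [/\ flips w = p.1, eqact (sec w false) p.2.1 &
                         eqact (sec w true) p.2.2]].
pose pairs n := flatten [seq [seq (x, y) | x <- L i, y <- L (contracted n - i)]
                        | i <- iota 0 (contracted n).+1].
exists (fun n => map pick [seq (b, p) | b <- [:: false; true], p <- pairs n]).
  move=> n w wn; have [v [wv av vn]] := reduce w.
  have vc : weight (sec v false) + weight (sec v true) <= contracted n.
    by rewrite /contracted; have := weight_sec_alternating av; lia.
  have [x Lx vx] := cL _ _ (leqnn (weight (sec v false))).
  have [|y Ly vy] := cL (contracted n - weight (sec v false)) (sec v true); first by lia.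
  exists (pick (flips v, (x, y))).
    apply/map_f/allpairs_f; first by case: flips.
    apply/flattenP; exists [seq (x, y) | x <- L (weight (sec v false)),
        y <- L (contracted n - weight (sec v false))]; last exact: allpairs_f.
    by apply/mapP; exists (weight (sec v false)); rewrite // mem_iota; lia.
  suff : eqact v (pick (flips v, (x, y))) by move=> vp u; rewrite wv vp.
  rewrite /pick; case: xgetP => [z _ /= [zf zx zy]|/(_ v)]; last by case.
  apply: eqact_cons; first by rewrite zf.
  by case=> u; rewrite ?zx ?zy ?vx ?vy.
move=> n; rewrite size_map size_allpairs /= size_flatten /shape -map_comp.
congr (_ * _); rewrite sumnE big_map -[iota _ _]/(index_iota 0 (contracted n).+1) big_mkord.
by apply: eq_bigr => i _; rewrite /= size_allpairs.
Qed.

Lemma covering_words : exists2 L, covering L & forall n, size (L n) <= 5 ^ n.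
Proof.
pose L := fix L n := if n is n'.+1 then
    [::] :: [seq s :: w | s <- [:: La; Lb; Lc; Ld], w <- L n'] else [:: [::]] : seq (seq letter).
exists L.
  move=> n w wn; exists w => //.
  have {wn}: size w <= n by have := size_weight w; lia.
  elim: n w => [|n IH] [|s w] // wn.
  change (s :: w \in [::] :: [seq s :: w | s <- [:: La; Lb; Lc; Ld], w <- L n]).
  rewrite in_cons; apply/orP; right.
  by apply: allpairs_f; [case: (s)|exact: IH].
elim=> //= n IH; rewrite !size_cat !size_map /=.
by have := expn_gt0 5 n; rewrite expnS; lia.
Qed.

Section Contraction.
Variable R : realType.
Local Open Scope ring_scope.

(** If L n has O(exp (a n)) elements, the next covering has, with
    m = 6 n / 7 + O(1), O(m exp (a m)) elements, and the factor m is absorbed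
    by replacing 6 / 7 with 13 / 14. *)
Lemma covering_exp k : exists L K, [/\ covering L, 0 < K :> R &
  forall n, (size (L n))%:R <= K * expR ((ln 5 * (13 / 14) ^+ k) * n%:R)].
Proof.
elim: k => [|k [L [K [cL K0 LK]]]].
  have [L cL Ln] := covering_words; exists L, 1; split=> // n.
  rewrite expr0 mulr1 mul1r mulrC expRM_natl lnK ?posrE//.
  by rewrite -natrX ler_nat.
have [L' cL' sL'] := covering_step cL.
set a := ln 5 * _ ^+ k in LK.
have a0 : 0 < a by rewrite mulr_gt0 ?exprn_gt0 ?divr_gt0// ln_gt0 ?ltr1n.
exists L', (2 * K ^+ 2 * expR (a * (24 / 7)) * (5 + 14 / a)); split=> //.
  by rewrite !mulr_gt0 ?expR_gt0 ?exprn_gt0// addr_gt0 ?divr_gt0.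
have aS : ln 5 * (13 / 14) ^+ k.+1 = a * (13 / 14) by rewrite /a exprSr; ring.
move=> n; rewrite sL' aS; set m := contracted n.
have mn : (m * 7 <= 6 * n + 24)%N by rewrite /m /contracted; lia.
have mn' : m%:R <= 6 / 7 * n%:R + 24 / 7 :> R.
  have : (m * 7)%:R <= (6 * n + 24)%:R :> R by rewrite ler_nat.
  by rewrite natrD !natrM; lra.
have sum_le : (\sum_(i < m.+1) size (L i) * size (L (m - i)))%N%:R <=
    m.+1%:R * (K ^+ 2 * expR (a * m%:R)) :> R.
  rewrite natr_sum; set c := _ * expR _.
  rewrite (_ : m.+1%:R * c = \sum_(i < m.+1) c); last first.
    by rewrite sumr_const card_ord mulr_natl.
  apply: ler_sum => i _; rewrite natrM.
  have -> : c =
      (K * expR (a * i%:R)) * (K * expR (a * (m - i)%N%:R)).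
    rewrite /c mulrACA -expr2 -expRD -mulrDr -natrD subnKC//.
    by rewrite -ltnS.
  by apply: ler_pM.
apply: (@le_trans _ _ (2 * (m.+1%:R * (K ^+ 2 * expR (a * m%:R))))).
  by rewrite natrM ler_pM2l.
have m1 : m.+1%:R <= (5 + 14 / a) * expR (a * n%:R / 14).
  have ge1 := expR_ge1Dx (a * n%:R / 14).
  apply: (@le_trans _ _ ((5 + 14 / a) * (1 + a * n%:R / 14))).
    rewrite -natr1; have -> : (5 + 14 / a) * (1 + a * n%:R / 14) =
      5 + n%:R + 14 / a + 5 * a * n%:R / 14 by field; rewrite gt_eqF.
    have : 0 <= 14 / a by rewrite divr_ge0// ltW.
    have : 0 <= a * n%:R by rewrite mulr_ge0// ltW.
    have : 0 <= n%:R :> R by [].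
    lra.
  by rewrite ler_pM2l// addr_gt0 ?divr_gt0.
have e1 : expR (a * m%:R) <= expR (a * (24 / 7)) * expR (a * (6 / 7) * n%:R).
  by rewrite -expRD ler_expR -mulrA -mulrDr ler_pM2l// addrC.
apply: (@le_trans _ _ (2 * ((5 + 14 / a) * expR (a * n%:R / 14) *
   (K ^+ 2 * (expR (a * (24 / 7)) * expR (a * (6 / 7) * n%:R)))))).
  rewrite ler_pM2l// ler_pM ?mulr_ge0 ?expR_ge0 ?exprn_ge0 ?(ltW K0)//.
  by rewrite ler_pM2l ?exprn_gt0.
rewrite le_eqVlt; apply/orP; left; apply/eqP.
have -> : expR (a * (13 / 14) * n%:R) = expR (a * n%:R / 14) * expR (a * (6 / 7) * n%:R).
  by rewrite -expRD; congr expR; field.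
by ring.
Qed.

Lemma covering_subexp (e : R) : 0 < e -> exists L K, [/\ covering L, 0 < K &
  forall n, (size (L n))%:R <= K * expR (e * n%:R)].
Proof.
move=> e0; have [k ke] : exists k, ln 5 * (13 / 14) ^+ k <= e :> R.
  have /cvgrPdist_lt /(_ (e / ln 5)) : (fun k => (13 / 14 : R) ^+ k) @ \oo --> (0 : R).
    by apply: cvg_expr; rewrite ger0_norm; lra.
  have l5 : 0 < ln 5 :> R by rewrite ln_gt0 ?ltr1n.
  move=> /(_ (divr_gt0 e0 l5))[k _ /(_ k (leqnn k))] /=.
  rewrite sub0r normrN ger0_norm ?exprn_ge0// ltr_pdivlMr// mulrC => /ltW.
  by exists k.
have [L [K [cL K0 LK]]] := covering_exp k; exists L, K; split=> // n.
by apply: (le_trans (LK n)); rewrite ler_pM2l// ler_expR ler_wpM2r.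
Qed.

End Contraction.

(** * Group-theoretic properties *)

Section GrigorchukGroup.
Variables (G : groupType) (E : seq letter -> G).
(** These hypotheses say that G is the group of transformations of binary words
    given by words in a, b, c, d. *)
Hypothesis E_cat : forall w v, E (w ++ v) = (E w * E v)%g.
Hypothesis E_eq : forall w v, E w = E v <-> eqact w v.
Hypothesis E_surj : forall g, exists w, E w = g.

Local Open Scope group_scope.

Lemma E_nil : E [::] = 1.
Proof. by apply: (mulgI (E [::])); rewrite -E_cat mulg1. Qed.

Lemma grigorchuk_finitely_generated : finitely_generated G.
Proof.
exists [fset g in [seq E [:: s] | s <- [:: La; Lb; Lc; Ld]]]%fset => K SK.
rewrite eqEsubset; split=> // g _; have [w <-] := E_surj g.
have KE s : K (E [:: s]).
  by apply: SK; case: s; rewrite /= !inE eqxx ?orbT.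
elim: w => [|s w IH]; first by rewrite E_nil; exact: subgroup1.
by rewrite -cat1s E_cat; apply: (@sgM _ K).
Qed.

Lemma grigorchuk_torsion : torsion_group G.
Proof.
move=> g; have [w <-] := E_surj g; have [n n0 w1] := word_torsion w.
exists n => //; have -> : E w ^+ n = E (flatten (nseq n w)).
  by elim: n {n0 w1} => [|n IH]; rewrite ?E_nil// expgS IH -E_cat.
rewrite -E_nil; apply/E_eq => u; rewrite -[RHS]w1.
by elim: n {n0 w1} => //= n IH; rewrite act_cat IH.
Qed.

Lemma spread_image_uniq k : uniq (map E (spread k)).
Proof.
rewrite map_inj_in_uniq ?spread_uniq// => w v kw kv /E_eq wv.
exact: spread_inj kw kv wv.
Qed.

Lemma grigorchuk_infinite : infinite_set [set: G].
Proof.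
move=> /finite_seqP[T GT].
have : (size (map E (spread (size T))) <= size T)%N.
  apply: uniq_leq_size; first exact: spread_image_uniq.
  by move=> g _; have : [set: G] g by []; rewrite GT.
rewrite size_map size_spread leqNgt => /negP; apply.
have lt2 n : (n < 2 ^ n)%N by exact: ltn_expl.
exact: ltn_trans (lt2 _) (lt2 _).
Qed.

Lemma act_size w u : size (act w u) = size u.
Proof.
have size1 s v : size (letter_act s v) = size v.
  elim: v s => //= e v IH s; case: (s == La) => //=.
  by case: letter_sec => //= t; rewrite IH.
by elim: w => //= s w IH; rewrite size1.
Qed.

Section Level.
Variable n : nat.

Lemma act_tuple_subproof w (u : n.-tuple bool) : size (act w u) == n.
Proof. by rewrite act_size size_tuple. Qed.

Definition act_tuple w (u : n.-tuple bool) := Tuple (act_tuple_subproof w u).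

Lemma act_tuple_inj w : injective (act_tuple w).
Proof. by move=> u v /(congr1 val) /= /act_inj uv; exact: val_inj. Qed.

Definition word g := xget [::] [set w | E w = g].

Lemma wordK g : E (word g) = g.
Proof.
have [w wg] := E_surj g.
by rewrite /word; case: xgetP => [v _ //|/(_ w)].
Qed.

(** Permutations compose from left to right and words from right to left,
    hence the inverse. *)
Definition level g : {perm n.-tuple bool} := (perm (@act_tuple_inj (word g)))^-1.

Lemma levelM : {morph level : g h / g * h}.
Proof.
move=> g h; rewrite /level -invMg; congr (_^-1); apply/permP => u.
rewrite permM !permE; apply: val_inj => /=; rewrite -act_cat.
by apply: (iffLR (E_eq _ _)); rewrite E_cat !wordK.
Qed.

HB.instance Definition _ := isMultiplicative.Build G {perm n.-tuple bool} level levelM.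

End Level.

(** An element that moves a binary word of length n survives in the group of
    permutations of the words of length n. *)
Lemma grigorchuk_residually_finite : residually_finite G.
Proof.
move=> g g1; have [w wg] := E_surj g.
have [u wu] : exists u, act w u != u.
  apply: contrapT => /forallNP h; apply: g1; rewrite -wg -E_nil.
  by apply/E_eq => u; apply/eqP; have /negP := h u; rewrite negbK.
exists {perm (size u).-tuple bool}, (level (size u)).
move=> /(congr1 (fun p : {perm (size u).-tuple bool} => (p^-1 : {perm _}) (in_tuple u))) /=.
rewrite /level invgK permE invg1 perm1 => /(congr1 val) /= E1.
move: wu; rewrite -[X in _ != X]E1 => /eqP; apply.
by apply: (iffLR (E_eq _ _)); rewrite wordK.
Qed.

Section GrowthFunction.
Variable S : {fset G}.

Lemma word_ball_sub w n : {subset w <= S} -> (size w <= n)%N ->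
  word_ball S n (\prod_(s <- w) s).
Proof. by move=> wS wn; exists w. Qed.

Lemma word_ball_weight : exists M, forall n,
  word_ball S n `<=` [set E w | w in [set w | (weight w <= M * n)%N]].
Proof.
exists (\max_(s <- S) weight (word s)) => n _ [w [wn wS ->]].
exists (flatten (map word w)).
  apply: leq_trans (leq_mul (leqnn _) wn); elim: w wS {wn} => //= s w IH sw.
  rewrite weight_cat mulnS leq_add//; last by apply: IH => t tw; rewrite sw// inE tw orbT.
  by apply: leq_bigmax_seq => //; apply: sw; exact: mem_head.
elim: w wS {wn} => [|s w IH] wS; first by rewrite big_nil E_nil.
rewrite big_cons /= E_cat wordK IH// => t tw; by rewrite wS// inE tw orbT.
Qed.

(** The constant M does not depend on L, so that the covering can be chosen
    after it. *)
Lemma growth_covering : exists M, forall L, covering L -> forall n,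
  finite_set (word_ball S n) /\ (growth_function S n <= size (L (M * n)%N))%N.
Proof.
have [M ballM] := word_ball_weight; exists M => L cL n.
have sub : word_ball S n `<=` [set` map E (L (M * n)%N)].
  move=> g /ballM[w wn <-]; have [v vL wv] := cL _ _ wn.
  by apply/mapP; exists v => //; exact/E_eq.
have fin : finite_set (word_ball S n).
  by apply: sub_finite_set sub _; apply/finite_seqP; exists (map E (L (M * n)%N)).
split=> //; rewrite -(size_map E); apply: uniq_leq_size; first exact: fset_uniq.
by move=> g; rewrite in_fset_set// inE => /sub.
Qed.

Hypothesis genS : generating_set S.

Lemma spanned_word_ball g : spanned S g -> exists n, word_ball S n g.
Proof.
suff : spanned S g -> exists2 w, {subset w <= S} & g = \prod_(s <- w) s.
  by move=> h /h[w wS ->]; exists (size w); exact: word_ball_sub.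
elim=> [|h s _ [w wS ->] sS]; first by exists [::]; rewrite ?big_nil.
exists (rcons w s); last by rewrite -cats1 big_cat big_seq1.
by move=> t; rewrite mem_rcons inE => /predU1P[->|/wS].
Qed.

Lemma word_ball_E : exists2 M, (0 < M)%N &
  forall w, word_ball S (M * size w) (E w).
Proof.
have letter_ball s : exists n, word_ball S n (E [:: s]).
  by apply: spanned_word_ball; apply: generating_spanned => //; exact: grigorchuk_torsion.
pose m s := projT1 (cid (letter_ball s)).
have mP s : word_ball S (m s) (E [:: s]) := projT2 (cid (letter_ball s)).
exists (maxn 1 (\max_(s : letter) m s)); first by rewrite leq_maxl.
set M := maxn _ _; elim=> [|s w [v [vM vS vE]]].
  by rewrite E_nil; exists [::]; rewrite big_nil.
have [x [xm xS xE]] := mP s; exists (x ++ v); split.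
- rewrite size_cat /= mulnS leq_add//; apply: (leq_trans xm).
  by apply: leq_trans (leq_maxr _ _); exact: leq_bigmax.
- by move=> t; rewrite mem_cat => /orP[/xS|/vS].
- by rewrite big_cat /= -xE -vE -E_cat.
Qed.

Lemma growth_spread : exists2 M, (0 < M)%N &
  forall k, (2 ^ (2 ^ k) <= growth_function S (M * (4 * 8 ^ k)))%N.
Proof.
have [M M0 ballM] := word_ball_E; exists M => // k.
have [L cL _] := covering_words; have [M' /(_ _ cL) fin] := growth_covering.
rewrite -size_spread -(size_map E); apply: uniq_leq_size.
  exact: spread_image_uniq.
move=> _ /mapP[w wk ->]; rewrite (in_fset_set (fin _).1); apply/mem_set.
have [v [vs vS ->]] := ballM w; exists v; split=> //.
by apply: leq_trans vs _; rewrite leq_mul2l spread_length ?orbT.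
Qed.

Section Reals.
Variable R : realType.
Local Open Scope ring_scope.

(** Used to let 2 ^ (2 ^ k) outgrow any power of 8 ^ k. *)
Lemma double_exp_gt (a : nat) : exists k, (a * k.+1 < 2 ^ k)%N.
Proof.
exists (2 * a + 2 * a)%N; rewrite expnD.
have h : (2 * a < 2 ^ (2 * a))%N by exact: ltn_expl.
by apply: leq_trans (leq_mul h h); nia.
Qed.

Lemma grigorchuk_not_polynomial : ~ polynomial_growth R (growth_function S).
Proof.
move=> [C [D [C0 D0 le]]]; have [M M0 spr] := growth_spread.
have [c Cc] : exists c : nat, C <= 2 ^+ c.
  exists (Num.bound C); apply: ltW; apply: lt_trans (archi_boundP (ltW C0)) _.
  by rewrite -natrX ltr_nat; exact: ltn_expl.
pose d := Num.bound D; have Dd : D <= d%:R by apply/ltW/archi_boundP/ltW.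
have [k] := double_exp_gt (c + (M + 5) * d); rewrite ltnNge => /negP; apply.
have n0 : (0 < M * (4 * 8 ^ k))%N by rewrite !muln_gt0 M0 expn_gt0.
have n_le : (M * (4 * 8 ^ k) <= 2 ^ (M + 2 + 3 * k))%N.
  by rewrite -addnA (expnD 2 M) (expnD 2 2) (expnM 2 3) leq_mul// ltnW// ltn_expl.
have := le _ n0; rewrite leNgt => /negP H; rewrite leqNgt; apply/negP => lt; apply: H.
apply: (@lt_le_trans _ _ ((2 ^ (2 ^ k))%N%:R)); last by rewrite ler_nat.
apply: (@le_lt_trans _ _ (2 ^+ c * (2 ^+ (M + 2 + 3 * k)) ^+ d)).
  rewrite ler_pM ?powR_ge0 ?(ltW C0)//.
  apply: (@le_trans _ _ ((M * (4 * 8 ^ k))%N%:R `^ d%:R)).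
    by apply: ler_powR => //; rewrite ler1n.
  rewrite powR_mulrn// ; apply: lerXn2r; rewrite ?nnegrE ?exprn_ge0//.
  by rewrite -natrX ler_nat.
rewrite -exprM -exprD -natrX ltr_nat ltn_exp2l//.
apply: leq_ltn_trans lt; nia.
Qed.

Lemma grigorchuk_not_exponential : ~ exponential_growth R (growth_function S).
Proof.
move=> [c c1 le]; have lc : 0 < ln c by rewrite ln_gt0.
have [M growM] := growth_covering.
(* A ball of radius n consists of elements of weight at most M n, so that this
   rate yields at most K exp (n ln c / 2) of them. *)
pose e := ln c / 2 / M.+1%:R; have e0 : 0 < e by rewrite !divr_gt0.
have [L [K [cL K0 LK]]] := covering_subexp e0.
have bound n : (0 < n)%N -> expR (ln c / 2 * n%:R) <= K.
  move=> n0; have [_ gL] := growM L cL n.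
  have : c ^+ n <= K * expR (e * (M * n)%N%:R).
    by apply: le_trans (le _ n0) _; apply: le_trans _ (LK _); rewrite ler_nat.
  rewrite {1}(_ : c = expR (ln c)); last by rewrite lnK// posrE; lra.
  rewrite -expRM_natl -ler_pdivrMr ?expR_gt0// -expRN -expRD.
  apply: le_trans; rewrite ler_expR.
  have : e * (M * n)%N%:R <= ln c / 2 * n%:R.
    rewrite natrM mulrA ler_wpM2r// /e -mulrA ger_pMr ?divr_gt0//.
    by rewrite mulrC ler_pdivrMr// mul1r ler_nat.
  by rewrite mulrC; lra.
have [N KN] : exists N : nat, K < ln c / 2 * N%:R.
  exists (Num.bound (K / (ln c / 2))); rewrite mulrC -ltr_pdivrMr ?divr_gt0//.
  by apply: archi_boundP; rewrite divr_ge0 ?ltW ?divr_gt0.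
have := bound N.+1 isT; rewrite leNgt => /negP; apply.
by apply: lt_le_trans (expR_ge1Dx _); rewrite -[N.+1%:R]natr1; lra.
Qed.

End Reals.
End GrowthFunction.

Lemma grigorchuk_intermediate_growth (R : realType) : intermediate_growth R G.
Proof.
split; first exact: grigorchuk_finitely_generated.
by move=> S _ genS; split; [exact: grigorchuk_not_polynomial|exact: grigorchuk_not_exponential].
Qed.

Lemma grigorchuk_not_elementary_amenable : ~ elementary_amenable G.
Proof.
move=> eaG; apply: grigorchuk_infinite; apply: torsion_elementary_amenable_finite => //.
  exact: grigorchuk_torsion.
exact: grigorchuk_finitely_generated.
Qed.

End GrigorchukGroup.

(** * The three behaviours *)

Lemma grigorchuk_word (g : subgroup_type grigorchuk) :
  exists w, word_homeo w = val g.
Proof. by have [w _ <-] := set_valP g; exists w. Qed.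

Definition grigorchuk_elt (w : seq letter) : subgroup_type grigorchuk :=
  exist (fun g => g \in (grigorchuk : set _)) (word_homeo w)
    (mem_set (ex_intro2 _ _ w I erefl)).

Lemma grigorchuk_elt_cat w v :
  grigorchuk_elt (w ++ v) = (grigorchuk_elt w * grigorchuk_elt v)%g.
Proof. by apply: val_inj; exact: word_homeo_cat. Qed.

Lemma grigorchuk_elt_eqact w v :
  grigorchuk_elt w = grigorchuk_elt v <-> eqact w v.
Proof.
split=> [/(congr1 val)/word_homeo_eqact //|/word_homeo_eqact wv].
exact: val_inj.
Qed.

Lemma grigorchuk_elt_surj g : exists w, grigorchuk_elt w = g.
Proof. by have [w wg] := grigorchuk_word g; exists w; exact: val_inj. Qed.

Theorem corollary1p2 (R : realType) :
  (exists (A : finType) (X : subshift A), minimal_subshift X /\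
     exists H : subgroup (homeomorphism X X),
       [/\ H `<=` full_group (subshift_map X),
           finitely_generated (subgroup_type H) &
           intermediate_growth R (subgroup_type H)]) /\
  (exists (A : finType) (X : subshift A), minimal_subshift X /\
     exists H : subgroup (homeomorphism X X),
       [/\ H `<=` full_group (subshift_map X),
           finitely_generated (subgroup_type H),
           infinite_set [set: subgroup_type H] &
           torsion_group (subgroup_type H)]) /\
  (exists (A : finType) (X : subshift A), minimal_subshift X /\
     exists H : subgroup (homeomorphism X X),
       [/\ H `<=` full_group (subshift_map X),
           finitely_generated (subgroup_type H),
           residually_finite (subgroup_type H) &
           ~ elementary_amenable (subgroup_type H)]).
Proof.
pose Ecat := grigorchuk_elt_cat; pose Eeq := grigorchuk_elt_eqact.
pose Esurj := grigorchuk_elt_surj.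
have fg := grigorchuk_finitely_generated Ecat Esurj.
split; [|split]; exists letter, ruler_subshift; split;
  [exact: (ruler_subshift_minimal R)| |exact: (ruler_subshift_minimal R)|
  |exact: (ruler_subshift_minimal R)|]; exists grigorchuk; split => //.
- exact: grigorchuk_full.
- exact: (grigorchuk_intermediate_growth Ecat Eeq Esurj).
- exact: grigorchuk_full.
- exact: (grigorchuk_infinite Eeq).
- exact: (grigorchuk_torsion Ecat Eeq Esurj).
- exact: grigorchuk_full.
- exact: (grigorchuk_residually_finite Ecat Eeq Esurj).
- exact: (grigorchuk_not_elementary_amenable Ecat Eeq Esurj).
Qed.
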